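(* Let $R$ be a ring, let $A, B \in R^{n \times n}$, let $(\mathcal{M}, \mathcal{R})$ be an $m$-compressed sensing scheme over $R$ with $m = m(n, t) \leq O(t n^{\alpha})$ for some $\alpha > 0$, and let $\textsc{ColMMV}$ be an algorithm for $\mathsf{Column\text{-}Wise\text{-}MMV}$ over $R$. Then on input $A, B$, Algorithm 2 outputs the matrix product $C=AB$. Furthermore, let $T_{\mathcal{M}}(n, t)$ and $T_{\mathcal{R}}(n, t)$ denote the running times of $\mathcal{M}$ and $\mathcal{R}$, respectively, let $T_{H}(n, t)$ denote the time needed to multiply $H := \mathcal{M}(1^n, 1^t)$ by an $n \times n$ matrix, and let $T_{V}(m, n, p)$ denote the running time of $\textsc{ColMMV}$ on input matrices in $R^{m \times n}$, $R^{n \times p}$, $R^{m \times p}$. If $\|AB\|_0 \leq O(n^{\delta})$ for some $0 \leq \delta \leq 2$, then for any constant $\varepsilon > 0$ the algorithm performs \[ \widetilde{O}\big(n^{\beta + \varepsilon} + T_{\mathcal{M}}(n, n) + n \cdot T_{\mathcal{R}}(n, n) + T_{H}(n, n) + T_{V}(n, n, n)\big) \] arithmetic operations over $R$, where $\beta := 2$ if $\delta + \alpha \leq 1 + \omega^{\perp}$ and $\beta := \omega(\delta + \alpha - 1, 1, 1)$ otherwise.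
   Context: $\|M\|_0$ denotes the number of non-zero entries; a vector is $t$-sparse if it has at most $t$ non-zero entries; $\widetilde{O}$ suppresses polylogarithmic factors; $\log$ is base 2. An $m$-compressed sensing scheme over $R$ (for non-decreasing integer-valued $m=m(n,t)$) is a pair $(\mathcal{M},\mathcal{R})$: on inputs $n,t$ in unary with $1\le t\le n$, $\mathcal{M}$ outputs $H\in R^{m\times n}$; on input $H\vec{x}$ for any $t$-sparse $\vec{x}\in R^n$, $\mathcal{R}$ outputs $\vec{x}$ (on other inputs it outputs some vector of $R^n$). $\mathsf{Column\text{-}Wise\text{-}MMV}_R$: given $A\in R^{m\times n}$, $B\in R^{n\times p}$, $C'\in R^{m\times p}$, output the set of indices $j\in[p]$ at which the $j$th column of $AB$ differs from the $j$th column of $C'$. Algorithm 2, on input $A,B\in R^{n\times n}$: set $J_0 := [n]$ and initialize $C'=(\vec{c}_1',\dots,\vec{c}_n')\in R^{n\times n}$ arbitrarily; for $i=0,1,\dots,\lceil \log n\rceil$: set $t:=2^i$; compute $H := \mathcal{M}(1^n,1^t)$; let $B'$ be the submatrix of $B$ consisting of the columns indexed by $J_i$; compute $D=(\vec{d}_j)_{j\in J_i} := HAB'$; compute $F=(\vec{f}_j)_{j\in J_i} := (\mathcal{R}(\vec{d}_j))_{j\in J_i}$; compute $J_{i+1} := \textsc{ColMMV}(A,B',F)$ (the indices $j\in J_i$ at which column $j$ of $AB'$ differs from $\vec{f}_j$); for each $j\in J_i\setminus J_{i+1}$ set $\vec{c}_j' := \vec{f}_j$. Finally return $C'$. $\omega(\alpha,\beta,\gamma)$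 is the infimum over $\omega'\ge0$ such that an $n^\alpha\times n^\beta$ and an $n^\beta\times n^\gamma$ matrix can be multiplied with $O(n^{\omega'})$ arithmetic operations, and $\omega^{\perp} := \sup\{\omega'\ge 0: \omega(1,1,\omega')=2\}$.
   Formalization: The running times T_M, T_R, T_H, T_V are assumed non-decreasing in their arguments (otherwise the bound in terms of T(n,n) fails), and Algorithm 2 uses t := min(2^i, n), since 2^i may exceed n, where the compressed sensing scheme is undefined. *)

(* Defs.v *)
From HB Require Import structures.
From mathcomp Require Import all_boot all_order all_algebra.
From mathcomp Require Import all_classical all_reals all_analysis.

Set Implicit Arguments.
Unset Strict Implicit.
Unset Printing Implicit Defensive.

Import Order.TTheory GRing.Theory Num.Theory.

Local Open Scope ring_scope.

(* Algebraic computation trees.  A program works on an append-only memory of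
   ring elements and handles them only through their addresses (natural
   numbers); each new value is stored at a fresh address, which is passed to
   the continuation.  Control flow and the returned object (for instance a
   matrix of addresses, or a set of indices) can therefore depend on the ring
   elements in memory only through the outcomes of equality tests.  As in the
   usual nonuniform model, an algorithm is a family of programs indexed by the
   sizes of its input. *)

Inductive arith := Add | Sub | Mul.

Inductive prog (K : Type) (X : Type) : Type :=
| Ret of X
| Cst of K & (nat -> prog K X)
| Op of arith & nat & nat & (nat -> prog K X)
| Test of nat & nat & (bool -> prog K X).

Arguments Ret {K X} _.
Arguments Cst {K X} _ _.
Arguments Op {K X} _ _ _ _.
Arguments Test {K X} _ _ _.

Fixpoint bind (K X Y : Type) (p : prog K X) (f : X -> prog K Y) : prog K Y :=
  match p with
  | Ret x => f x
  | Cst c k => Cst c (fun a => bind (k a) f)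
  | Op o a b k => Op o a b (fun c => bind (k c) f)
  | Test a b k => Test a b (fun t => bind (k t) f)
  end.

Notation "'let!' x := p 'in' q" := (bind p (fun x => q))
  (at level 200, x name, p at level 100, q at level 200).

Fixpoint forM (K I X : Type) (l : seq I) (f : I -> X -> prog K X) (x : X) :
    prog K X :=
  if l is i :: l' then let! y := f i x in forM l' f y else Ret x.

Fixpoint for_cols (K : Type) (m n : nat) :
    ('I_n -> prog K 'cV[nat]_m) -> prog K 'M[nat]_(m, n) :=
  match n with
  | 0 => fun _ => Ret (const_mx 0%N)
  | n'.+1 => fun f =>
      let! c := f ord0 in
      let! M := for_cols (fun j => f (lift ord0 j)) in
      Ret (row_mx c M : 'M[nat]_(m, 1 + n'))
  end.

Section Execution.
Variables (K : Type) (S : pzRingType) (phi : K -> S).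

Record outcome (X : Type) :=
  Outcome { result : X; memory : seq S; ops : nat }.

Definition tick X (o : outcome X) : outcome X :=
  Outcome (result o) (memory o) (ops o).+1.

Definition arith_fun (o : arith) (x y : S) : S :=
  match o with Add => x + y | Sub => x - y | Mul => x * y end.

(* Ring operations and equality tests cost one unit each, constants are free. *)
Fixpoint run X (p : prog K X) (s : seq S) : outcome X :=
  match p with
  | Ret x => Outcome x s 0
  | Cst c k => run (k (size s)) (rcons s (phi c))
  | Op o a b k =>
      tick (run (k (size s)) (rcons s (arith_fun o s`_a s`_b)))
  | Test a b k => tick (run (k (s`_a == s`_b)) s)
  end.

Definition holds (s : seq S) m n (a : 'M[nat]_(m, n)) (M : 'M[S]_(m, n)) :=
  forall i j, (a i j < size s)%N /\ s`_(a i j) = M i j.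

Definition outputs (s : seq S) m n (p : prog K 'M[nat]_(m, n))
    (M : 'M[S]_(m, n)) :=
  holds (memory (run p s)) (result (run p s)) M.

End Execution.

(* Programs over R itself. *)
Notation exec := (run idfun).
Notation computes := (outputs idfun).

Definition nnz (R : pzRingType) m n (M : 'M[R]_(m, n)) : nat :=
  #|[set ij : 'I_m * 'I_n | M ij.1 ij.2 != 0]|.

Definition sparse (R : pzRingType) (t n : nat) (x : 'cV[R]_n) : bool :=
  (nnz x <= t)%N.

Definition nondecreasing2 (f : nat -> nat -> nat) :=
  forall n t n' t', (1 <= t <= n)%N -> (t' <= n')%N ->
    (n <= n')%N -> (t <= t')%N -> (f n t <= f n' t')%N.

Definition nondecreasing3 (f : nat -> nat -> nat -> nat) :=
  forall m n p m' n' p', (m <= m')%N -> (n <= n')%N -> (p <= p')%N ->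
    (f m n p <= f m' n' p')%N.

Section CompressedSensing.
Variables (R : pzRingType) (m : nat -> nat -> nat).

Record cs_pair := CsPair {
  sensing : forall n t : nat, prog R 'M[nat]_(m n t, n);
  recovery : forall n t : nat, 'cV[nat]_(m n t) -> prog R 'cV[nat]_n }.

Arguments recovery _ n t _ : clear implicits.

(* H n t is the matrix that the sensing algorithm outputs on (1^n, 1^t). *)
Definition cs_scheme (H : forall n t, 'M[R]_(m n t, n)) (MR : cs_pair) :=
  nondecreasing2 m /\
  forall n t, (1 <= t <= n)%N ->
    [/\ forall s, computes s (sensing MR n t) (H n t),
        forall s a x, sparse t x -> holds s a (H n t *m x) ->
          computes s (recovery MR n t a) x &
        forall s a y, holds s a y -> exists x, computes s (recovery MR n t a) x].

Definition sensing_time (MR : cs_pair) (T : nat -> nat -> nat) :=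
  forall n t s, (1 <= t <= n)%N ->
    (ops (exec (sensing MR n t) s) <= T n t)%N.

Definition recovery_time (MR : cs_pair) (T : nat -> nat -> nat) :=
  forall n t s a y, (1 <= t <= n)%N -> holds s a y ->
    (ops (exec (recovery MR n t a) s) <= T n t)%N.

(* Multiplying H n t by an n x n matrix takes at most T n t operations. *)
Definition sensing_mul_time (H : forall n t, 'M[R]_(m n t, n))
    (T : nat -> nat -> nat) :=
  forall n t, (1 <= t <= n)%N ->
    exists P : 'M[nat]_(m n t, n) -> 'M[nat]_n -> prog R 'M[nat]_(m n t, n),
    forall s aH aX X, holds s aH (H n t) -> holds s aX X ->
      computes s (P aH aX) (H n t *m X) /\
      (ops (exec (P aH aX) s) <= T n t)%N.

End CompressedSensing.

Arguments recovery {R m} _ n t _.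

Definition col_mmv_alg (R : pzRingType) :=
  forall m n p, 'M[nat]_(m, n) -> 'M[nat]_(n, p) -> 'M[nat]_(m, p) ->
    prog R {set 'I_p}.

Definition column_wise_mmv (R : pzRingType) (V : col_mmv_alg R) :=
  forall m n p s a b c (A : 'M[R]_(m, n)) (B : 'M[R]_(n, p)) (C : 'M[R]_(m, p)),
    holds s a A -> holds s b B -> holds s c C ->
    result (exec (V m n p a b c) s) =
      [set j | col j (A *m B) != col j C]%SET.

Definition col_mmv_time (R : pzRingType) (V : col_mmv_alg R)
    (T : nat -> nat -> nat -> nat) :=
  forall m n p s a b c (A : 'M[R]_(m, n)) (B : 'M[R]_(n, p)) (C : 'M[R]_(m, p)),
    holds s a A -> holds s b B -> holds s c C ->
    (ops (exec (V m n p a b c) s) <= T m n p)%N.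

Section Algorithm2.
Variables (R : pzRingType) (m : nat -> nat -> nat) (MR : cs_pair R m).
Variable V : col_mmv_alg R.

(* Algorithm 2 does not prescribe how the product HAB' is evaluated: the
   subroutine P that evaluates it is a parameter. *)
Definition product_alg :=
  forall n t p, 'M[nat]_(m n t, n) -> 'M[nat]_n -> 'M[nat]_(n, p) ->
    prog R 'M[nat]_(m n t, p).

Definition correct_product (H : forall n t, 'M[R]_(m n t, n))
    (P : product_alg) :=
  forall n t p s aH a b (A : 'M[R]_n) (B : 'M[R]_(n, p)), (1 <= t <= n)%N ->
    holds s aH (H n t) -> holds s a A -> holds s b B ->
    computes s (P n t p aH a b) (H n t *m A *m B).

Variable P : product_alg.

(* The submatrices B', D and F are indexed by 'I_#|J|, where l stands for the
   index enum_val l of J.  The sparsity 2^i is truncated to n, because the last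
   power of two may exceed n and the scheme is only defined for t <= n. *)
Definition alg2_step n (a b : 'M[nat]_n) (i : nat)
    (st : {set 'I_n} * 'M[nat]_n) : prog R ({set 'I_n} * 'M[nat]_n) :=
  let: (J, c) := st in
  let t := minn (2 ^ i) n in
  let! aH := sensing MR n t in
  let b' := colsub (fun l : 'I_#|J| => enum_val l) b in
  let! d := P aH a b' in
  let! f := for_cols (fun l : 'I_#|J| => recovery MR n t (col l d)) in
  let! L := V a b' f in
  Ret ([set enum_val l | l in L]%SET,
       \matrix_(k, j)
         if [pick l : 'I_#|J| | (enum_val l == j) && (l \notin L)] is Some l
         then f k l else c k j).

(* c holds the arbitrary initial value of C'; up_log 2 n is the ceiling of the
   binary logarithm of n. *)
Definition alg2 n (a b c : 'M[nat]_n) : prog R 'M[nat]_n :=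
  let! st := forM (iota 0 (up_log 2 n).+1) (alg2_step a b)
                  ([set: 'I_n]%SET, c) in
  Ret st.2.

End Algorithm2.

Section RectangularExponents.
Variable R : pzRingType.

Definition central (S : pzRingType) (x : S) := forall y : S, x * y = y * x.

Fixpoint central_consts X (p : prog R X) : Prop :=
  match p with
  | Ret _ => True
  | Cst c k => central c /\ forall a, central_consts (k a)
  | Op _ _ _ k => forall a, central_consts (k a)
  | Test _ _ k => forall t, central_consts (k t)
  end.

(* As usual in algebraic complexity, an algorithm that multiplies matrices over
   R has to multiply matrices of (noncommuting) indeterminates over R: it is
   correct under substitution of elements of any ring S over R, in particular
   of R itself and of the matrix rings over R.  The coefficients it uses are
   scalars, i.e., they commute with the indeterminates. *)
Definition mul_within (p q r L : nat) :=
  exists P : 'M[nat]_(p, q) -> 'M[nat]_(q, r) -> prog R 'M[nat]_(p, r),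
    (forall a b, central_consts (P a b)) /\
    forall (S : pzRingType) (phi : {rmorphism R -> S}),
      (forall c : R, central c -> central (phi c)) ->
    forall s a b (A : 'M[S]_(p, q)) (B : 'M[S]_(q, r)),
      holds s a A -> holds s b B ->
      outputs phi s (P a b) (A *m B) /\ (ops (run phi (P a b) s) <= L)%N.

Variable K : realType.

Definition pow_dim (n : nat) (a : K) : nat := `|Num.ceil (n%:R `^ a)|%N.

Definition omega (a b c : K) : K :=
  inf [set w | 0 <= w /\ exists C : K, forall n, (0 < n)%N ->
         exists L, mul_within (pow_dim n a) (pow_dim n b) (pow_dim n c) L /\
                   L%:R <= C * n%:R `^ w]%classic.

Definition omega_perp : K := sup [set w | 0 <= w /\ omega 1 1 w = 2]%classic.

End RectangularExponents.

Definition log2 (K : realType) (n : nat) : K := ln n%:R / ln 2.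

(* Main.v *)
(* After round i of the algorithm only columns of AB with more than 2^i nonzero
   entries are left, so the q columns of AB that are nonzero and still to be
   computed in round i satisfy q t <= 2 |AB|_0 with t = 2^i; hence the sensing
   matrix H, with m = O(t n^alpha) rows, satisfies m q = O(n^(delta + alpha)).
   The zero columns are found by one call of ColMMV against the zero matrix, and
   H A B' is evaluated as (H A) B' if m <= n and as H (A B') otherwise, so that it
   remains to multiply an M x n by an n x q matrix with M, q <= n and
   M q = O(n^s), s = delta + alpha.

   For this, an algorithm for the shape (p, q, r) is run over words of degree one
   in the entries of each factor; reading off the coefficients turns it into a
   trilinear decomposition of the same size over the center of R, which can be
   transposed and used recursively.  A product of k1 copies of the shape
   <N^(s-1), N, N> and k2 copies of its transpose, N constant, contains every
   shape <M, n, q> as above for suitable k1, k2 with N^(k1 + k2) = O(n), and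
   its cost is n^(omega(s-1,1,1) + o(1)) because the rank of <N^(s-1), N, N>,
   which is at least N^2, dominates the cost of the linear steps. *)
From HB Require Import structures.
Require Import Defs.
From mathcomp Require Import all_boot all_order all_algebra.
From mathcomp Require Import all_classical all_reals all_analysis.
From mathcomp Require Import zify ring lra.

Set Implicit Arguments.
Unset Strict Implicit.
Unset Printing Implicit Defensive.

Import Order.TTheory GRing.Theory Num.Theory.
Local Open Scope ring_scope.

(** * Program logic *)

Section ProgramLogic.
Variables (K : Type) (S : pzRingType) (phi : K -> S) (timed : bool).

Lemma run_bind X Y (p : prog K X) (f : X -> prog K Y) s :
  run phi (bind p f) s =
  let o := run phi p s in let o' := run phi (f (result o)) (memory o) in
  Outcome (result o') (memory o') (ops o + ops o').
Proof.
elim: p s => [x|c k IH|o a b k IH|a b k IH] s /=; last 3 first.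
- by rewrite IH.
- by rewrite IH.
- by rewrite IH.
by case: (run phi (f x) s).
Qed.

Lemma prefix_run X (p : prog K X) s : prefix s (memory (run phi p s)).
Proof.
elim: p s => [x|c k IH|o a b k IH|a b k IH] s /=.
- exact: prefix_refl.
- exact: prefix_trans (prefix_rcons _ _) (IH _ _).
- exact: prefix_trans (prefix_rcons _ _) (IH _ _).
- exact: IH.
Qed.

Definition stores (s : seq S) (a : nat) (x : S) :=
  (a < size s)%N /\ s`_a = x.

Lemma stores_prefix s s' a x : prefix s s' -> stores s a x -> stores s' a x.
Proof.
move=> /prefixP[z ->] [lt_a <-]; split; last by rewrite nth_cat lt_a.
by rewrite size_cat ltn_addr.
Qed.

Lemma holds_prefix s s' m n (a : 'M[nat]_(m, n)) (M : 'M[S]_(m, n)) :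
  prefix s s' -> holds s a M -> holds s' a M.
Proof. by move=> pre sa i j; apply: stores_prefix pre (sa i j). Qed.

(* The bound on the number of operations is only claimed if timed holds. *)
Definition spec X (p : prog K X) s (Q : seq S -> X -> Prop) c :=
  Q (memory (run phi p s)) (result (run phi p s)) /\
  (timed ==> (ops (run phi p s) <= c)%N).

Lemma spec_weaken X (p : prog K X) s (Q Q' : seq S -> X -> Prop) c c' :
  spec p s Q c -> (c <= c')%N ->
  (forall s' x, prefix s s' -> Q s' x -> Q' s' x) -> spec p s Q' c'.
Proof.
move=> [Qp le_c] le_cc' QQ'; split; first by apply: QQ' Qp; apply: prefix_run.
by apply/implyP => b1; apply: leq_trans le_cc'; apply: (implyP le_c).
Qed.

Lemma spec_ret X (x : X) s (Q : seq S -> X -> Prop) : Q s x -> spec (Ret x) s Q 0.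
Proof. by split=> //; apply: implybT. Qed.

Lemma spec_bind X Y (p : prog K X) (f : X -> prog K Y) s Q Q' c c' :
  spec p s Q c ->
  (forall s' x, prefix s s' -> Q s' x -> spec (f x) s' Q' c') ->
  spec (bind p f) s Q' (c + c').
Proof.
move=> [Qp le_c] Qf; rewrite /spec run_bind /=.
have [Q'f le_c'] := Qf _ _ (prefix_run p s) Qp.
by split=> //; apply/implyP => b1; apply: leq_add; [apply: (implyP le_c)|apply: (implyP le_c')].
Qed.

Lemma spec_cst c s : spec (Cst c Ret) s (fun s' a => stores s' a (phi c)) 0.
Proof. by split; rewrite /= ?implybT // /stores size_rcons nth_rcons ltnn eqxx. Qed.

Lemma spec_op o s a a' x y : stores s a x -> stores s a' y ->
  spec (Op o a a' Ret) s (fun s' c => stores s' c (arith_fun o x y)) 1.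
Proof.
move=> [_ <-] [_ <-]; split; rewrite /= ?implybT //.
by rewrite /stores size_rcons nth_rcons ltnn eqxx.
Qed.

(** The value [x0] is never read: it only provides a function on the empty ordinal. *)
Fixpoint for_ord X (x0 : X) n : ('I_n -> prog K X) -> prog K ('I_n -> X) :=
  match n with
  | 0 => fun _ => Ret (fun=> x0)
  | n'.+1 => fun f =>
      let! x := f ord0 in
      let! F := for_ord x0 (fun i => f (lift ord0 i)) in
      Ret (fun i => oapp F x (unlift ord0 i))
  end.

(** Memory only grows, so with a monotone [Q] what an iteration establishes survives all later
    ones. *)
Lemma spec_for_ord X (x0 : X) n (f : 'I_n -> prog K X) s
    (Q : 'I_n -> seq S -> X -> Prop) c :
  (forall i s' s'' x, prefix s' s'' -> Q i s' x -> Q i s'' x) ->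
  (forall i s', prefix s s' -> spec (f i) s' (Q i) c) ->
  spec (for_ord x0 f) s (fun s' F => forall i, Q i s' (F i)) (n * c).
Proof.
elim: n f s Q => [|n IH] f s Q monoQ Qf.
  by apply: spec_ret => -[].
rewrite mulSn; apply: spec_bind (Qf _ _ (prefix_refl _)) _ => s1 x ss1 Qx.
rewrite -[(n * c)%N]addn0; apply: spec_bind.
  apply: (IH _ s1 (fun i => Q (lift ord0 i))); first by move=> i; apply: monoQ.
  by move=> i s2 s12; apply: Qf; apply: prefix_trans s12.
move=> s2 F s12 QF; apply: spec_ret => i.
case: unliftP => [j ->|->] /=; first exact: QF.
exact: monoQ s12 Qx.
Qed.

Lemma spec_for_cols m n (f : 'I_n -> prog K 'cV[nat]_m) s
    (Q : 'I_n -> seq S -> 'cV[nat]_m -> Prop) c :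
  (forall i s' s'' x, prefix s' s'' -> Q i s' x -> Q i s'' x) ->
  (forall i s', prefix s s' -> spec (f i) s' (Q i) c) ->
  spec (for_cols f) s (fun s' F => forall i, Q i s' (col i F)) (n * c).
Proof.
elim: n f s Q => [|n IH] f s Q monoQ Qf.
  by apply: spec_ret => -[].
rewrite mulSn; apply: spec_bind (Qf _ _ (prefix_refl _)) _ => s1 x ss1 Qx.
rewrite -[(n * c)%N]addn0; apply: spec_bind.
  apply: (IH _ s1 (fun i => Q (lift ord0 i))); first by move=> i; apply: monoQ.
  by move=> i s2 s12; apply: Qf; apply: prefix_trans s12.
move=> s2 F s12 QF; apply: spec_ret => i.
case: (unliftP ord0 i) => [j ->|->].
  have -> : col (lift ord0 j) (row_mx x F : 'M[nat]_(m, 1 + n)) = col j F.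
    by rewrite -[RHS](colKr j x F); congr col; apply: val_inj.
  exact: QF.
have -> : col ord0 (row_mx x F : 'M[nat]_(m, 1 + n)) = x.
  transitivity (col ord0 x); last by apply/matrixP => k l; rewrite mxE (ord1 l).
  by rewrite -[RHS](colKl ord0 x F); congr col; apply: val_inj.
exact: monoQ s12 Qx.
Qed.

Definition for_mx m n (f : 'I_m -> 'I_n -> prog K nat) : prog K 'M[nat]_(m, n) :=
  let! F := for_ord (fun=> 0%N) (fun i => for_ord 0%N (f i)) in
  Ret (\matrix_(i, j) F i j).

Lemma spec_for_mx m n (f : 'I_m -> 'I_n -> prog K nat) s (M : 'M[S]_(m, n)) c :
  (forall i j s', prefix s s' ->
     spec (f i j) s' (fun s'' a => stores s'' a (M i j)) c) ->
  spec (for_mx f) s (fun s' a => holds s' a M) (m * n * c).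
Proof.
move=> Qf; rewrite -[(m * n * c)%N]addn0 -mulnA; apply: spec_bind.
  apply: (@spec_for_ord _ _ _ _ _ (fun i s' F => forall j, stores s' (F j) (M i j))).
    by move=> i s' s'' F s12 QF j; apply: stores_prefix s12 (QF j).
  move=> i s' ss'.
  apply: (@spec_for_ord _ _ _ _ _ (fun j s' a => stores s' a (M i j))).
    by move=> j s1 s2 a; apply: stores_prefix.
  move=> j s'' s12.
  by apply: Qf; apply: prefix_trans s12.
move=> s' F ss' QF; apply: spec_ret => i j.
by rewrite mxE; apply: QF.
Qed.

(** [K] is a bare type here, so the start value [k0] is passed explicitly and later required to map
    to 0. Each term costs one multiplication and one addition, constants being free. *)
Fixpoint lincomb (k0 : K) I (l : seq I) (coef : I -> K) (addr : I -> nat) :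
    prog K nat :=
  if l is i :: l' then
    let! c := Cst (coef i) Ret in
    let! x := Op Mul c (addr i) Ret in
    let! y := lincomb k0 l' coef addr in
    Op Add x y Ret
  else Cst k0 Ret.

Lemma spec_lincomb k0 I (l : seq I) coef addr (v : I -> S) s :
  phi k0 = 0 -> (forall i, stores s (addr i) (v i)) ->
  spec (lincomb k0 l coef addr) s
    (fun s' a => stores s' a (\sum_(i <- l) phi (coef i) * v i)) (2 * size l).
Proof.
move=> phi0; elim: l s => [|i l IH] s sv.
  by have := spec_cst k0 s; rewrite phi0 big_nil.
rewrite big_cons [size _]/=.
have -> : (2 * (size l).+1 = 0 + (1 + (2 * size l + 1)))%N by lia.
apply: spec_bind (spec_cst _ _) _ => s1 a ss1 sa.
apply: spec_bind; first exact: spec_op sa (stores_prefix ss1 (sv i)).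
move=> s2 a' s12 sb; apply: spec_bind.
  by apply: IH => j; apply: stores_prefix (prefix_trans ss1 s12) (sv j).
move=> s3 c s23 sc; exact: spec_op (stores_prefix s23 sb) sc.
Qed.

End ProgramLogic.

(** * Programs with central constants *)

Section Central.
Variable R : pzRingType.

Lemma central_bind X Y (p : prog R X) (f : X -> prog R Y) :
  central_consts p -> (forall x, central_consts (f x)) ->
  central_consts (bind p f).
Proof.
move=> + Hf; elim: p => [x|c k IH|o a b k IH|a b k IH] //=.
- by move=> [cc Hk]; split=> // a; apply: IH.
- by move=> Hk a'; apply: IH.
- by move=> Hk t; apply: IH.
Qed.

Lemma central_for_ord X (x0 : X) n (f : 'I_n -> prog R X) :
  (forall i, central_consts (f i)) -> central_consts (for_ord x0 f).
Proof.
elim: n f => [|n IH] f Hf //=.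
by apply: central_bind => // x; apply: central_bind => //; apply: IH.
Qed.

Lemma central_for_mx m n (f : 'I_m -> 'I_n -> prog R nat) :
  (forall i j, central_consts (f i j)) -> central_consts (for_mx f).
Proof.
move=> Hf; apply: central_bind => //; apply: central_for_ord => i.
exact: central_for_ord.
Qed.

Lemma central_lincomb k0 I (l : seq I) (coef : I -> R) addr :
  central k0 -> (forall i, central (coef i)) ->
  central_consts (lincomb k0 l coef addr).
Proof.
move=> c0 cc; elim: l => [|i l IH] //=; split=> // a b.
exact: central_bind.
Qed.

Lemma central0 : central (0 : R).
Proof. by move=> x; rewrite mul0r mulr0. Qed.

Lemma central1 : central (1 : R).
Proof. by move=> x; rewrite mul1r mulr1. Qed.

Lemma centralD (x y : R) : central x -> central y -> central (x + y).
Proof. by move=> cx cy z; rewrite mulrDl mulrDr cx cy. Qed.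

Lemma centralN (x : R) : central x -> central (- x).
Proof. by move=> cx z; rewrite mulNr mulrN cx. Qed.

Lemma centralM (x y : R) : central x -> central y -> central (x * y).
Proof. by move=> cx cy z; rewrite -mulrA cy mulrA cx -mulrA. Qed.

Lemma central_nat n : central (n%:R : R).
Proof.
elim: n => [|n IH]; first exact: central0.
by rewrite mulrS; apply: centralD => //; apply: central1.
Qed.

End Central.

(** * Trilinear decompositions as recursive algorithms *)

Section Rank.
Variable R : pzRingType.

(* A trilinear decomposition of the p x q by q x r matrix multiplication tensor
   into L terms, over the center of R. *)
Definition rank_within (p q r L : nat) :=
  exists (u : 'I_L -> 'I_p -> 'I_q -> R) (v : 'I_L -> 'I_q -> 'I_r -> R)
         (w : 'I_L -> 'I_p -> 'I_r -> R),
  [/\ forall l i j, central (u l i j), forall l j k, central (v l j k),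
      forall l i k, central (w l i k) &
      forall i' k' i j j' k, \sum_l w l i' k' * (u l i j * v l j' k) =
        [&& i == i', j == j' & k == k']%:R].

Lemma rank_within_le p q r L p' q' r' : (p' <= p)%N -> (q' <= q)%N ->
  (r' <= r)%N -> rank_within p q r L -> rank_within p' q' r' L.
Proof.
move=> lep leq ler [u [v [w [cu cv cw E]]]].
exists (fun l i j => u l (widen_ord lep i) (widen_ord leq j)).
exists (fun l j k => v l (widen_ord leq j) (widen_ord ler k)).
exists (fun l i k => w l (widen_ord lep i) (widen_ord ler k)).
by split=> // *; rewrite E.
Qed.

Lemma rank_within_leq p q r L L' :
  (L <= L')%N -> rank_within p q r L -> rank_within p q r L'.
Proof.
move=> /subnKC <-; move: (L' - L)%N => d [u [v [w [cu cv cw E]]]].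
pose ext T (f : 'I_L -> T) (x : T) (l : 'I_(L + d)) :=
  if fintype.split l is inl l0 then f l0 else x.
have extl T (f : 'I_L -> T) x l : ext T f x (lshift d l) = f l.
  by rewrite /ext; case: splitP => j /= e; [congr f; apply: val_inj|
     have := ltn_ord l; lia].
have extr T (f : 'I_L -> T) x l : ext T f x (rshift L l) = x.
  by rewrite /ext; case: splitP => j //= e; have := ltn_ord j; lia.
have cext I J (f : 'I_L -> I -> J -> R) : (forall l i j, central (f l i j)) ->
    forall l i j, central (ext _ f (fun _ _ => 0) l i j).
  by move=> cf l i j; rewrite /ext; case: fintype.split => // _; apply: central0.
exists (ext _ u (fun _ _ => 0)), (ext _ v (fun _ _ => 0)), (ext _ w (fun _ _ => 0)).
split; [exact: cext|exact: cext|exact: cext|move=> i' k' i j j' k].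
rewrite big_split_ord /= [X in _ + X]big1 ?addr0.
  by rewrite -(E i' k' i j j' k); apply: eq_bigr => l _; rewrite !extl.
by move=> l _; rewrite !extr mul0r.
Qed.

(** Transposition reverses the order of the two factors; centrality of [v] allows this even though R
    need not be commutative. *)
Lemma rank_within_tr p q r L : rank_within p q r L -> rank_within r q p L.
Proof.
move=> [u [v [w [cu cv cw E]]]].
exists (fun l i j => v l j i), (fun l i j => u l j i), (fun l i k => w l k i).
split=> // i' k' i j j' k.
transitivity (\sum_l w l k' i' * (u l k j' * v l j i)).
  by apply: eq_bigr => l _; rewrite cv.
by rewrite E [j' == j]eq_sym; case: (k == k'); case: (i == i'); case: (j == j').
Qed.

(** One term for each triple of indices, that is, for each scalar product of the schoolbook
    method. *)
Lemma rank_within_naive p q r : rank_within p q r (p * (q * r)).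
Proof.
pose T := ('I_p * ('I_q * 'I_r))%type.
have cT : #|{: T}| = (p * (q * r))%N by rewrite !card_prod !card_ord.
rewrite -cT.
exists (fun l i j => ((enum_val l).1 == i)%:R * ((enum_val l).2.1 == j)%:R).
exists (fun l j k => ((enum_val l).2.1 == j)%:R * ((enum_val l).2.2 == k)%:R).
exists (fun l i k => ((enum_val l).1 == i)%:R * ((enum_val l).2.2 == k)%:R).
split; try by move=> *; apply: centralM; apply: central_nat.
move=> i' k' i j j' k.
pose F (x : T) : R := ((x.1 == i')%:R * (x.2.2 == k')%:R) *
  (((x.1 == i)%:R * (x.2.1 == j)%:R) * ((x.2.1 == j')%:R * (x.2.2 == k)%:R)).
transitivity (\sum_(x : T) F x); first by rewrite (reindex _ (onW_bij _ (@enum_val_bij T))).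
rewrite (bigD1 (i, (j, k))) //= big1 ?addr0.
  by rewrite /F /= !eqxx /= !mul1r !mulr1 -!natrM !mulnb; congr (_%:R);
     case: (i == i'); case: (j == j'); case: (k == k').
move=> [x [y z]]; rewrite /F -!natrM !mulnb => /=.
rewrite -pair_eqE /pair_eq /= -pair_eqE /pair_eq /=.
by case: (x == i); case: (y == j); case: (z == k); rewrite /= ?andbF.
Qed.

End Rank.

(** The inverse of [mxvec_index]: it splits an index of a block matrix into the block and the
    position inside it. *)
Definition unindex m n (x : 'I_(m * n)) : 'I_m * 'I_n :=
  enum_val (cast_ord (esym (mxvec_cast m n)) x).

Lemma unindexK m n (x : 'I_(m * n)) :
  mxvec_index (unindex x).1 (unindex x).2 = x.
Proof.
by rewrite /mxvec_index /unindex -surjective_pairing enum_valK cast_ordKV.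
Qed.

(** * Composing a decomposition with an algorithm on blocks *)

Section Compose.
Variable R : pzRingType.

(** One entry of one block of the product, with [z] the inner index within blocks. Entries of [A]
    and [B] never change order; only the coefficient from [v] moves past an entry of [A], which its
    centrality permits. *)
Lemma rank_within_compose_sum (S : pzRingType) (phi : {rmorphism R -> S})
    (p q r L q' : nat) u v w (A : 'I_p -> 'I_q -> 'I_q' -> S)
    (B : 'I_q -> 'I_q' -> 'I_r -> S) i k :
  (forall c : R, central c -> central (phi c)) ->
  (forall l i j, central (v l i j)) ->
  (forall i' k' i j j' k, \sum_(l < L) w l i' k' * (u l i j * v l j' k) =
        [&& i == i', j == j' & k == k']%:R) ->
  \sum_(l < L) phi (w l i k) * (\sum_z
     (\sum_(x : 'I_p * 'I_q) phi (u l x.1 x.2) * A x.1 x.2 z) *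
     (\sum_(y : 'I_q * 'I_r) phi (v l y.1 y.2) * B y.1 z y.2)) =
  \sum_j \sum_z A i j z * B j z k.
Proof.
move=> cphi cv E.
transitivity (\sum_z \sum_(x : 'I_p * 'I_q) \sum_(y : 'I_q * 'I_r)
   [&& x.1 == i, x.2 == y.1 & y.2 == k]%:R * (A x.1 x.2 z * B y.1 z y.2)).
  under eq_bigr => l _ do rewrite mulr_sumr.
  rewrite exchange_big; apply: eq_bigr => z _.
  under eq_bigr => l _ do rewrite mulr_suml mulr_sumr.
  rewrite exchange_big; apply: eq_bigr => x _.
  under eq_bigr => l _ do rewrite mulr_sumr mulr_sumr.
  rewrite exchange_big; apply: eq_bigr => y _.
  (* The trilinear identity collapses the sum over the terms [l] to an indicator. *)
  rewrite -(rmorph_nat phi) -E rmorph_sum mulr_suml; apply: eq_bigr => l _.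
  rewrite !rmorphM -!mulrA; congr (_ * (_ * _)).
  by rewrite mulrA -(cphi _ (cv _ _ _)) -mulrA.
rewrite [RHS]exchange_big; apply: eq_bigr => z _.
transitivity (\sum_(x : 'I_p * 'I_q) (x.1 == i)%:R * (A x.1 x.2 z * B x.2 z k)).
  apply: eq_bigr => -[x1 x2] _ /=.
  rewrite (bigD1 (x2, k)) //= !eqxx /= andbT big1 ?addr0 // => -[y1 y2].
  rewrite -pair_eqE /pair_eq /= eq_sym.
  by case: (x2 == y1); case: (y2 == k); rewrite //= ?andbF ?mul0r.
rewrite -(pair_bigA _ (fun x1 x2 => (x1 == i)%:R * (A x1 x2 z * B x2 z k))) /=.
rewrite (bigD1 i) //= [X in _ + X]big1 ?addr0.
  by apply: eq_bigr => j _; rewrite eqxx mul1r.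
by move=> x1 /negPf x1i; rewrite big1 // => j _; rewrite x1i mul0r.
Qed.

(** The matrices are cut into blocks of the shape handled by the algorithm. Each of the [L] terms
    takes linear combinations of the blocks of both factors and one call of the algorithm; then
    every output entry combines [L] results. *)
Lemma mul_within_compose p q r L p' q' r' T :
  rank_within R p q r L -> mul_within R p' q' r' T ->
  mul_within R (p * p') (q * q') (r * r')
    (L * (p' * q' * (2 * (p * q)) + (q' * r' * (2 * (q * r)) + T))
     + p * p' * (r * r') * (2 * L)).
Proof.
move=> [u [v [w [cu cv cw E]]]] [P [cP specP]].
pose pre (m n m' n' : nat) (c : 'I_m -> 'I_n -> R)
    (a : 'M[nat]_(m * m', n * n')) : prog R 'M[nat]_(m', n') :=
  for_mx (fun i j => lincomb 0 (enum {: 'I_m * 'I_n})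
    (fun x => c x.1 x.2) (fun x => a (mxvec_index x.1 i) (mxvec_index x.2 j))).
exists (fun a b =>
  let! Z := for_ord (const_mx 0%N) (fun l : 'I_L =>
    let! X := pre p q p' q' (u l) a in
    let! Y := pre q r q' r' (v l) b in
    P X Y) in
  for_mx (fun x y => lincomb 0 (enum 'I_L)
    (fun l => w l (unindex x).1 (unindex y).1)
    (fun l => Z l (unindex x).2 (unindex y).2))).
split=> [a b|S phi cphi s a b A B sa sb].
  have cpre m n m' n' c x :
      (forall i j, central (c i j)) -> central_consts (pre m n m' n' c x).
    move=> cc; apply: central_for_mx => i j.
    by apply: central_lincomb => //; apply: central0.
  apply: central_bind => [|Z].
    apply: central_for_ord => l; apply: central_bind => [|X]; first exact: cpre.
    by apply: central_bind => [|Y]; [apply: cpre|apply: cP].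
  apply: central_for_mx => x y; apply: central_lincomb => //.
  exact: central0.
pose preV (m n m' n' : nat) (c : 'I_m -> 'I_n -> R)
    (M : 'M[S]_(m * m', n * n')) : 'M[S]_(m', n') :=
  \matrix_(i, j) \sum_(x : 'I_m * 'I_n)
    phi (c x.1 x.2) * M (mxvec_index x.1 i) (mxvec_index x.2 j).
have spec_pre m n m' n' c x (M : 'M[S]_(m * m', n * n')) s' : holds s' x M ->
    spec phi true (pre m n m' n' c x) s' (fun s'' y => holds s'' y (preV m n m' n' c M))
      (m' * n' * (2 * (m * n))).
  move=> sM; apply: spec_for_mx => i j s1 ss1.
  have -> : (m * n)%N = size (enum {: 'I_m * 'I_n}).
    by rewrite -cardE card_prod !card_ord.
  rewrite mxE -big_enum.
  apply: spec_lincomb => [|y]; first exact: rmorph0.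
  exact: stores_prefix ss1 (sM _ _).
suff: spec phi true (let! Z := for_ord (const_mx 0%N) (fun l : 'I_L =>
    let! X := pre p q p' q' (u l) a in
    let! Y := pre q r q' r' (v l) b in
    P X Y) in
  for_mx (fun x y => lincomb 0 (enum 'I_L)
    (fun l => w l (unindex x).1 (unindex y).1)
    (fun l => Z l (unindex x).2 (unindex y).2))) s (fun s' c => holds s' c (A *m B))
   (L * (p' * q' * (2 * (p * q)) + (q' * r' * (2 * (q * r)) + T))
     + p * p' * (r * r') * (2 * L)) by [].
apply: spec_bind.
  apply: (@spec_for_ord _ _ _ _ _ _ _ _ _ (fun l s' c =>
    holds s' c (preV _ _ _ _ (u l) A *m preV _ _ _ _ (v l) B))).
    by move=> l s1 s2 c; apply: holds_prefix.
  move=> l s1 ss1; apply: spec_bind.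
    exact: spec_pre (holds_prefix ss1 sa).
  move=> s2 X s12 sX; apply: spec_bind.
    exact: spec_pre (holds_prefix (prefix_trans ss1 s12) sb).
  move=> s3 Y s23 sY; apply: specP => //.
  exact: holds_prefix s23 sX.
move=> s1 Z ss1 sZ; apply: spec_for_mx => x y s2 s12.
have -> : (A *m B) x y = \sum_(l <- enum 'I_L) phi (w l (unindex x).1 (unindex y).1) *
    (preV _ _ _ _ (u l) A *m preV _ _ _ _ (v l) B) (unindex x).2 (unindex y).2.
  rewrite big_enum /=.
  pose A' i j z := A (mxvec_index i (unindex x).2) (mxvec_index j z).
  pose B' j z k := B (mxvec_index j z) (mxvec_index k (unindex y).2).
  have := rank_within_compose_sum A' B' (unindex x).1 (unindex y).1 cphi cv E.
  rewrite mxE /A' /B' !unindexK => EAB.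
  transitivity (\sum_j \sum_z A x (mxvec_index j z) * B (mxvec_index j z) y).
    rewrite pair_bigA /= (reindex _ (curry_mxvec_bij q q')) /=.
    by apply: eq_bigr => -[].
  rewrite -EAB; apply: eq_bigr => l _; rewrite mxE; congr (_ * _).
  by apply: eq_bigr => z _; rewrite !mxE.
apply: spec_weaken; last by move=> s3 z _; apply.
  apply: spec_lincomb; first exact: rmorph0.
  by move=> l; apply: stores_prefix s12 (sZ l _ _).
by rewrite size_enum_ord.
Qed.

(** The smaller matrices are padded with zeros, all of them represented by one address. *)
Lemma mul_within_le p q r L p' q' r' L' : (p' <= p)%N -> (q' <= q)%N ->
  (r' <= r)%N -> (L <= L')%N -> mul_within R p q r L -> mul_within R p' q' r' L'.
Proof.
move=> lep leq ler leL [P [cP specP]].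
pose pad m n m' n' (z : nat) (a : 'M[nat]_(m', n')) : 'M[nat]_(m, n) :=
  \matrix_(i, j) if (insub (val i), insub (val j)) is (Some i', Some j')
                 then a i' j' else z.
exists (fun a b => let! z := Cst 0 Ret in
  let! c := P (pad _ _ _ _ z a) (pad _ _ _ _ z b) in
  Ret (\matrix_(i, k) c (widen_ord lep i) (widen_ord ler k))).
split=> [a b|S phi cphi s a b A B sa sb].
  apply: central_bind => [|z]; first by split=> //; apply: central0.
  exact: central_bind.
pose padV m n m' n' (M : 'M[S]_(m', n')) : 'M[S]_(m, n) :=
  \matrix_(i, j) if (insub (val i), insub (val j)) is (Some i', Some j')
                 then M i' j' else 0.
have spec_pad m n m' n' s' z x (M : 'M[S]_(m', n')) : stores s' z 0 ->
    holds s' x M -> holds s' (pad m n m' n' z x) (padV m n m' n' M).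
  move=> sz sM i j; rewrite !mxE.
  by case: insubP => [i' _ _|_] //; case: insubP => [j' _ _|_].
suff: spec phi true (let! z := Cst 0 Ret in
  let! c := P (pad _ _ _ _ z a) (pad _ _ _ _ z b) in
  Ret (\matrix_(i, k) c (widen_ord lep i) (widen_ord ler k))) s
    (fun s' c => holds s' c (A *m B)) (0 + (L + 0)).
  by rewrite add0n addn0 => -[h1 h2]; split; [|apply: leq_trans leL].
apply: spec_bind; first exact: spec_cst.
move=> s1 z ss1; rewrite rmorph0 => sz.
apply: (spec_bind (Q := fun s' c => holds s' c (padV p q p' q' A *m padV q r q' r' B))).
  apply: (specP S phi cphi s1 _ _ (padV p q p' q' A) (padV q r q' r' B)).
    exact: spec_pad sz (holds_prefix ss1 sa).
  exact: spec_pad sz (holds_prefix ss1 sb).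
move=> s2 c s12 sc; apply: spec_ret => i k; rewrite [X in (X < _)%N]mxE [X in _`_X]mxE.
have := sc (widen_ord lep i) (widen_ord ler k); rewrite [X in _ = X]mxE.
suff -> : (A *m B) i k = \sum_j padV p q p' q' A (widen_ord lep i) j *
    padV q r q' r' B j (widen_ord ler k) by [].
pose F j := A i j * B j k.
pose G (j : 'I_q) := if insub (val j) is Some j' then F j' else 0.
rewrite mxE; transitivity (\sum_(j < q) G j).
  rewrite (bigID (fun j : 'I_q => (j < q')%N)) /= [X in _ + X]big1 ?addr0.
    rewrite (big_ord_narrow leq); apply: eq_bigr => j _; rewrite /G /F /=.
    by rewrite insubT //= => ltj; congr (A i _ * B _ k); apply: val_inj.
  by move=> j /negPf ltj; rewrite /G insubF.
apply: eq_bigr => j _; rewrite /G /F !mxE.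
have insub_widen n' n (le : (n' <= n)%N) (l : 'I_n') :
  insub (val (widen_ord le l)) = Some l by apply: (valK l).
rewrite !insub_widen.
by case: insubP => [j' _ _|_] //; rewrite mul0r.
Qed.
End Compose.

(** * Decompositions from algorithms *)

(* Noncommutative polynomials in letters a_x (x in U) and b_y (y in V),
   truncated to the words 1, a_x, b_y and a_x b_y. *)
Definition words (R : pzRingType) (U V : finType) : Type :=
  (R * {ffun U -> R} * {ffun V -> R} * {ffun U * V -> R})%type.

Section Words.
Variables (R : pzRingType) (U V : finType).
Local Notation W := (words R U V).

HB.instance Definition _ := GRing.Zmodule.on W.

Definition word1 : W := (1, 0, 0, 0).
Definition wordM (s t : W) : W :=
  (s.1.1.1 * t.1.1.1,
   [ffun x => s.1.1.1 * t.1.1.2 x + s.1.1.2 x * t.1.1.1],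
   [ffun y => s.1.1.1 * t.1.2 y + s.1.2 y * t.1.1.1],
   [ffun z => s.1.1.1 * t.2 z + s.1.1.2 z.1 * t.1.2 z.2 + s.2 z * t.1.1.1]).

Lemma words_eqP (s t : W) :
  s.1.1.1 = t.1.1.1 -> s.1.1.2 =1 t.1.1.2 -> s.1.2 =1 t.1.2 -> s.2 =1 t.2 ->
  s = t.
Proof.
case: s t => [[[a b] c] d] [[[a' b'] c'] d'] /=.
by move=> -> /ffunP-> /ffunP-> /ffunP->.
Qed.

Lemma wordMA : associative wordM.
Proof.
move=> s t v; apply: words_eqP => [|x|y|z] /=; rewrite ?ffunE /= ?ffunE /=.
- by rewrite mulrA.
- by rewrite !mulrDl !mulrDr !mulrA !addrA.
- by rewrite !mulrDl !mulrDr !mulrA !addrA.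
- rewrite !mulrDl !mulrDr !mulrA -!addrA; congr (_ + (_ + _)).
  by rewrite addrCA.
Qed.

Lemma word1M : left_id word1 wordM.
Proof.
move=> s; apply: words_eqP => [|x|y|z] /=; rewrite ?ffunE /= ?ffunE /=;
by rewrite ?mul1r ?mul0r ?addr0.
Qed.

Lemma wordM1 : right_id word1 wordM.
Proof.
move=> s; apply: words_eqP => [|x|y|z] /=; rewrite ?ffunE /= ?ffunE /=;
by rewrite ?mulr1 ?mulr0 ?add0r.
Qed.

Lemma wordMDl : left_distributive wordM +%R.
Proof.
move=> s t v; apply: words_eqP => [|x|y|z] /=; rewrite ?ffunE /= ?ffunE /=.
- by rewrite mulrDl.
- by rewrite !mulrDl addrACA.
- by rewrite !mulrDl addrACA.
- by rewrite !mulrDl [RHS]addrACA; congr (_ + _); rewrite addrACA.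
Qed.

Lemma wordMDr : right_distributive wordM +%R.
Proof.
move=> s t v; apply: words_eqP => [|x|y|z] /=; rewrite ?ffunE /= ?ffunE /=.
- by rewrite mulrDr.
- by rewrite !mulrDr addrACA.
- by rewrite !mulrDr addrACA.
- by rewrite !mulrDr [RHS]addrACA; congr (_ + _); rewrite addrACA.
Qed.

HB.instance Definition _ :=
  GRing.Zmodule_isPzRing.Build W wordMA word1M wordM1 wordMDl wordMDr.

Definition word_cst (c : R) : W := (c, 0, 0, 0).

Lemma word_cst_zmod : zmod_morphism word_cst.
Proof.
by move=> c d; apply: words_eqP => [|x|y|z] /=; rewrite ?ffunE /= ?ffunE ?subr0.
Qed.

Lemma word_cst_monoid : monoid_morphism word_cst.
Proof.
split=> // c d; apply: words_eqP => [|x|y|z] /=;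
by rewrite ?ffunE /= ?ffunE ?mulr0 ?mul0r ?addr0.
Qed.

HB.instance Definition _ := GRing.isZmodMorphism.Build R W word_cst word_cst_zmod.
HB.instance Definition _ := GRing.isMonoidMorphism.Build R W word_cst word_cst_monoid.

Lemma central_word_cst c : central c -> central (word_cst c).
Proof.
move=> cc s; apply: words_eqP => [|x|y|z] /=; rewrite ?ffunE /= ?ffunE;
by rewrite ?mulr0 ?mul0r ?addr0 ?add0r.
Qed.

(* The a_x b_y coefficients of t are combinations of the L rank one forms
   gu l x * gv l y. *)
Definition spanned (L : nat) (gu : nat -> U -> R) (gv : nat -> V -> R) (t : W) :=
  [/\ central t.1.1.1, forall x, central (t.1.1.2 x), forall y, central (t.1.2 y) &
   exists w : nat -> R, (forall l, central (w l)) /\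
     forall z, t.2 z = \sum_(l < L) w l * (gu l z.1 * gv l z.2)].

(** Families of forms are functions on all of [nat], so that appending a form does not change their
    type. *)
Definition extend T (f : nat -> T) (L : nat) (x : T) l := if l == L then x else f l.

Lemma extend_last T (f : nat -> T) L x : extend f L x L = x.
Proof. by rewrite /extend eqxx. Qed.

Lemma extend_lt T (f : nat -> T) L x (l : 'I_L) : extend f L x l = f l.
Proof. by rewrite /extend ltn_eqF. Qed.

Lemma spanned_extend (L : nat) (gu : nat -> U -> R) (gv : nat -> V -> R)
    x y (t : W) (w : nat -> R) (c : R) : (forall l, central (w l)) ->
  central c -> central t.1.1.1 -> (forall x, central (t.1.1.2 x)) ->
  (forall y, central (t.1.2 y)) ->
  (forall z, t.2 z = (\sum_(l < L) w l * (gu l z.1 * gv l z.2)) + c * (x z.1 * y z.2)) ->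
  spanned L.+1 (extend gu L x) (extend gv L y) t.
Proof.
move=> cw cc c1 c2 c3 E; split=> //; exists (extend w L c).
split=> [l|z]; first by rewrite /extend; case: eqP.
rewrite big_ord_recr /= !extend_last E; congr (_ + _).
by apply: eq_bigr => l _; rewrite !extend_lt.
Qed.

Lemma spanned_widen L gu gv x y t : spanned L gu gv t ->
  spanned L.+1 (extend gu L x) (extend gv L y) t.
Proof.
move=> [c1 c2 c3 [w [cw E]]]; apply: (@spanned_extend _ _ _ _ _ _ w 0) => //.
  exact: central0.
by move=> z; rewrite E mul0r addr0.
Qed.

Lemma spannedD L gu gv s t : spanned L gu gv s -> spanned L gu gv t ->
  spanned L gu gv (s + t).
Proof.
move=> [c1 c2 c3 [w [cw E]]] [d1 d2 d3 [w' [cw' E']]]; split=> [|x|y|] /=.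
- exact: centralD.
- by rewrite ffunE; apply: centralD.
- by rewrite ffunE; apply: centralD.
exists (fun l => w l + w' l); split=> [l|z]; first exact: centralD.
rewrite ffunE E E' -big_split /=; apply: eq_bigr => l _.
by rewrite -mulrDl.
Qed.

Lemma spannedN L gu gv s : spanned L gu gv s -> spanned L gu gv (- s).
Proof.
move=> [c1 c2 c3 [w [cw E]]]; split=> [|x|y|] /=.
- exact: centralN.
- by rewrite ffunE; apply: centralN.
- by rewrite ffunE; apply: centralN.
exists (fun l => - w l); split=> [l|z]; first exact: centralN.
by rewrite ffunE E -sumrN; apply: eq_bigr => l _; rewrite -mulNr.
Qed.

Lemma spanned_cst L gu gv c : central c -> spanned L gu gv (word_cst c).
Proof.
move=> cc; split=> [|x|y|] //=; try by rewrite ffunE; apply: central0.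
exists (fun=> 0); split=> [l|z]; first exact: central0.
by rewrite ffunE big1 // => l _; rewrite mul0r.
Qed.

(** Truncation leaves three contributions to the coefficient of a word a_x b_y: a central constant
    times an old combination, twice, and the product of the two linear parts, which is the one new
    form. *)
Lemma spannedM L gu gv s t : spanned L gu gv s -> spanned L gu gv t ->
  spanned L.+1 (extend gu L s.1.1.2) (extend gv L t.1.2) (s * t).
Proof.
move=> [c1 c2 c3 [w [cw E]]] [d1 d2 d3 [w' [cw' E']]].
apply: (@spanned_extend _ _ _ _ _ _ (fun l => t.1.1.1 * w l + s.1.1.1 * w' l) 1).
- by move=> l; apply: centralD; apply: centralM.
- exact: central1.
- exact: centralM.
- by move=> x /=; rewrite ffunE; apply: centralD; apply: centralM.
- by move=> y /=; rewrite ffunE; apply: centralD; apply: centralM.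
move=> z /=; rewrite ffunE mul1r addrAC; congr (_ + _).
rewrite addrC -d1 E E' !mulr_sumr -big_split /=; apply: eq_bigr => l _.
by rewrite mulrDl !mulrA.
Qed.

(** Only a multiplication adds a form. Tests are harmless because a single run is considered and the
    branch it takes is followed. *)
Lemma run_spanned X (p : prog R X) (s : seq W) L gu gv :
  central_consts p ->
  (forall l x, central (gu l x)) -> (forall l y, central (gv l y)) ->
  (forall i, spanned L gu gv s`_i) ->
  exists L' gu' gv', [/\ (L' <= L + ops (run word_cst p s))%N,
    forall l x, central (gu' l x), forall l y, central (gv' l y) &
    forall i, spanned L' gu' gv' (memory (run word_cst p s))`_i].
Proof.
have Srcons L' gu' gv' (s' : seq W) t : (forall i, spanned L' gu' gv' s'`_i) ->
    spanned L' gu' gv' t -> forall i, spanned L' gu' gv' (rcons s' t)`_i.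
  move=> Hs Ht i; rewrite nth_rcons; case: ifP => // _; case: ifP => // _.
  (* An address beyond the memory reads the default 0, which is a constant word. *)
  by rewrite -[0]/(word_cst 0); apply: spanned_cst; apply: central0.
elim: p s L gu gv => [x|c k IH|o a b k IH|a b k IH] s L gu gv /=.
- by move=> _ cu cv Hs; exists L, gu, gv; rewrite addn0.
- move=> [cc ck] cu cv Hs; apply: IH => //.
  by apply: Srcons => //; apply: spanned_cst.
- move=> ck cu cv Hs.
  case: o => /=.
  + have Ht : spanned L gu gv (s`_a + s`_b) by apply: spannedD.
    have [L' [gu' [gv' [le cu' cv' H']]]] := IH (size s) _ _ _ _ (ck (size s)) cu cv (Srcons _ _ _ _ _ Hs Ht).
    by exists L', gu', gv'; split=> //; rewrite addnS ltnW.
  + have Ht : spanned L gu gv (s`_a - s`_b).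
      by apply: spannedD => //; apply: spannedN.
    have [L' [gu' [gv' [le cu' cv' H']]]] := IH (size s) _ _ _ _ (ck (size s)) cu cv (Srcons _ _ _ _ _ Hs Ht).
    by exists L', gu', gv'; split=> //; rewrite addnS ltnW.
  + have [_ cua _ _] := Hs a; have [_ _ cvb _] := Hs b.
    have Ht := spannedM (Hs a) (Hs b).
    have Hs' i := spanned_widen (s`_a).1.1.2 (s`_b).1.2 (Hs i).
    have cu' l x : central (extend gu L (s`_a).1.1.2 l x) by rewrite /extend; case: eqP.
    have cv' l y : central (extend gv L (s`_b).1.2 l y) by rewrite /extend; case: eqP.
    have [L' [gu' [gv' [le cu2 cv2 H']]]] := IH (size s) _ _ _ _ (ck (size s)) cu' cv' (Srcons _ _ _ _ _ Hs' Ht).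
    by exists L', gu', gv'; split=> //; rewrite addnS -addSn.
- move=> ck cu cv Hs.
  have [L' [gu' [gv' [le cu' cv' H']]]] := IH (s`_a == s`_b) _ _ _ _ (ck _) cu cv Hs.
  by exists L', gu', gv'; split=> //; rewrite addnS ltnW.
Qed.

End Words.

(** The program is run on two matrices of distinct letters. Every coefficient of a word a_x b_y in
    an entry of the product is 0 or 1, and [run_spanned] expresses it through at most [L] rank one
    forms; their weights, chosen per output entry, become [w]. *)
Lemma mul_within_rank (R : pzRingType) p q r L :
  mul_within R p q r L -> rank_within R p q r L.
Proof.
move=> [P [cP specP]].
pose U : finType := ('I_p * 'I_q)%type; pose V : finType := ('I_q * 'I_r)%type.
pose W := words R U V.
pose gA (x : U) : W := (0, [ffun x' => (x' == x)%:R], 0, 0).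
pose gB (y : V) : W := (0, 0, [ffun y' => (y' == y)%:R], 0).
pose s : seq W := [seq gA x | x <- enum U] ++ [seq gB y | y <- enum V].
pose indexU (x : U) := index x (enum U).
pose indexV (y : V) := index y (enum V).
pose a : 'M[nat]_(p, q) := \matrix_(i, j) indexU (i, j).
pose b : 'M[nat]_(q, r) := \matrix_(j, k) (size (enum U) + indexV (j, k))%N.
pose A : 'M[W]_(p, q) := \matrix_(i, j) gA (i, j).
pose B : 'M[W]_(q, r) := \matrix_(j, k) gB (j, k).
have iU (x : U) : (indexU x < size (enum U))%N by rewrite index_mem mem_enum.
have iV (x : V) : (indexV x < size (enum V))%N by rewrite index_mem mem_enum.
have sa : holds s a A.
  move=> i j; rewrite !mxE /s; split.
    by rewrite size_cat (size_map gA) (size_map gB) ltn_addr // iU.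
  by rewrite nth_cat (size_map gA) iU (nth_map ((i, j) : U)) ?iU // nth_index ?mem_enum.
have sb : holds s b B.
  move=> j k; rewrite !mxE /s; split.
    by rewrite size_cat (size_map gA) (size_map gB) ltn_add2l iV.
  rewrite nth_cat (size_map gA) ifN ?addKn; last by rewrite -leqNgt leq_addr.
  by rewrite (nth_map ((j, k) : V)) ?iV // nth_index ?mem_enum.
have [Pout leL] := specP W (word_cst U V) (@central_word_cst R U V) s a b A B sa sb.
(* The input consists of single letters, so the run starts with no form at all. *)
have s0 i : spanned 0 (fun _ _ => 0) (fun _ _ => 0) s`_i.
  have span (t : W) : t.1.1.1 = 0 -> (forall x, central (t.1.1.2 x)) ->
      (forall y, central (t.1.2 y)) -> t.2 = 0 ->
      spanned 0 (fun _ _ => 0) (fun _ _ => 0) t.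
    move=> t1 t2 t3 t4; split=> //; first by rewrite t1; apply: central0.
    exists (fun=> 0); split=> [l|z]; first exact: central0.
    by rewrite t4 ffunE big_ord0.
  case: (ltnP i (size s)) => [lti|gei]; last first.
    by rewrite nth_default //; apply: span => // ?; rewrite ffunE; apply: central0.
  have : s`_i \in s by apply: mem_nth.
  rewrite mem_cat => /orP[] /mapP[x _ ->]; apply: span => // ?;
  rewrite ffunE; solve [exact: central_nat | exact: central0].
have c0 I : forall (l : nat) (x : I), central (0 : R) by move=> *; apply: central0.
have [L' [gu [gv [leL' cu cv sp]]]] := run_spanned (cP a b) (c0 U) (c0 V) s0.
apply: (rank_within_leq (leq_trans leL' leL)).
have /choice[w Ew] (ik : 'I_p * 'I_r) : exists w : nat -> R,
    (forall l, central (w l)) /\ forall z,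
    ((A *m B) ik.1 ik.2).2 z = \sum_(l < L') w l * (gu l z.1 * gv l z.2).
  have [_ <-] := Pout ik.1 ik.2.
  by have [_ _ _] := sp (result (run (word_cst U V) (P a b) s) ik.1 ik.2).
exists (fun l i j => gu l (i, j)), (fun l j k => gv l (j, k)), (fun l i k => w (i, k) l).
split=> // [l i k|i' k' i j j' k]; first by have [] := Ew (i, k).
have [_ /(_ ((i, j), (j', k))) /= <-] := Ew (i', k').
(* Reading off a coefficient is additive, hence passes through the sum over the inner index, of
   which only [j] can contribute. *)
rewrite mxE (big_morph (fun t : W => t.2 (i, j, (j', k))) (id1 := 0) (op1 := +%R));
  [|by move=> x y; rewrite ffunE|by rewrite ffunE].
rewrite (bigD1 j) //= big1 ?addr0 => [|j0 /negPf j0j].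
  rewrite !mxE /= !ffunE /= ?ffunE ?mul0r ?mulr0 ?add0r ?addr0 -natrM mulnb.
  rewrite -!pair_eqE /pair_eq /= eqxx andbT.
  by case: (i == i'); case: (j' =P j) => [->|/eqP]; rewrite ?eqxx //= eq_sym => /negPf->.
rewrite !mxE /= !ffunE /= ?ffunE ?mul0r ?mulr0 ?add0r ?addr0 -natrM mulnb.
by rewrite -!pair_eqE /pair_eq /= [j == j0]eq_sym j0j andbF.
Qed.

(** * The center as a commutative ring, and a lower bound for the rank *)

Section Center.
Variable R : pzRingType.

Definition in_center : {pred R} := fun x => `[< central x >].

Lemma in_centerP x : reflect (central x) (x \in in_center).
Proof. exact: asboolP. Qed.

Lemma in_center_subring : GRing.subring_closed in_center.
Proof.
split=> [|x y /in_centerP cx /in_centerP cy|x y /in_centerP cx /in_centerP cy].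
- by apply/in_centerP; apply: central1.
- by apply/in_centerP; apply: centralD => //; apply: centralN.
- by apply/in_centerP; apply: centralM.
Qed.



Record center := Center { center_val :> R; _ : center_val \in in_center }.

HB.instance Definition _ := [isSub of center for center_val].
HB.instance Definition _ := [Choice of center by <:].
HB.instance Definition _ :=
  GRing.SubChoice_isSubPzRing.Build R in_center center in_center_subring.

Lemma center_mulC : commutative (@GRing.mul center).
Proof. by move=> x y; apply: val_inj; rewrite !rmorphM; apply: (in_centerP _ (valP x)). Qed.

HB.instance Definition _ := GRing.PzRing_hasCommutativeMul.Build center center_mulC.

End Center.

(** Padding with a zero column and a zero row makes both factors square without changing the
    product; determinants then give 1 = 0. *)
Lemma mulmx1_max (Z : comPzRingType) L (X : 'M[Z]_(L + 1, L)) (Y : 'M[Z]_(L, L + 1)) :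
  X *m Y = 1%:M -> (1 : Z) = 0.
Proof.
move=> XY.
have : row_mx X (0 : 'M[Z]_(L + 1, 1)) *m col_mx Y (0 : 'M[Z]_(1, L + 1)) = 1%:M.
  by rewrite mul_row_col XY mul0mx addr0.
move/(congr1 determinant); rewrite det_mulmx det1 => <-.
rewrite (expand_det_col _ (rshift L ord0)) big1 ?mul0r // => i _.
by rewrite row_mxEr mxE mul0r.
Qed.

(** With both row indices fixed to 0, the trilinear identity says that an identity matrix indexed by
    the pairs (j, k) factors through [L] terms. If there were more than [L] pairs, any [L + 1] of
    them would contradict [mulmx1_max] over the center, where determinants are available. *)
Lemma rank_within_ge (R : pzRingType) p q r L : (0 < p)%N -> (1 : R) != 0 ->
  rank_within R p q r L -> (q * r <= L)%N.
Proof.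
case: p => // p _ R1 [u [v [w [cu cv cw E]]]].
rewrite leqNgt; apply/negP => ltL.
have q0 : (0 < q)%N by case: (q) ltL.
have r0 : (0 < r)%N by case: (r) ltL; rewrite // muln0.
pose z (x : R) (cx : central x) : center R := Center (introT (in_centerP x) cx).
have leL : (L + 1 <= #|{: 'I_q * 'I_r}|)%N by rewrite card_prod !card_ord addn1.
pose e (x : 'I_(L + 1)) : 'I_q * 'I_r := enum_val (widen_ord leL x).
have e_inj : injective e.
  by move=> x y /enum_val_inj /(congr1 val) /= xy; apply: val_inj.
pose j0 := Ordinal q0.
pose X := \matrix_(x < L + 1, l < L)
  (z _ (cw l ord0 (e x).2) * z _ (cu l ord0 (e x).1)).
pose Y := \matrix_(l < L, y < L + 1) z _ (cv l (e y).1 (e y).2).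
have : X *m Y = 1%:M.
  apply/matrixP => x y; apply: val_inj; rewrite !mxE rmorph_sum.
  transitivity ([&& (ord0 : 'I_p.+1) == ord0, (e x).1 == (e y).1 & (e y).2 == (e x).2]%:R : R).
    by rewrite -E; apply: eq_bigr => l _; rewrite !mxE !rmorphM mulrA.
  rewrite eqxx andTb rmorphMn rmorph1; congr (_%:R).
  by rewrite [(e y).2 == _]eq_sym -(inj_eq e_inj) -pair_eqE.
move/mulmx1_max/(congr1 val); rewrite rmorph1 rmorph0 => /eqP.
by rewrite (negPf R1).
Qed.

Lemma mul_within_trivial (R : pzRingType) p q r :
  (1 : R) = 0 -> mul_within R p q r 0.
Proof.
move=> R1; exists (fun _ _ => Cst 0 (fun z => Ret (const_mx z))).
split=> [a b|S phi cphi s a b A B sa sb]; first by split=> //; apply: central0.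
have S0 (x : S) : x = 0 by rewrite -[x]mul1r -(rmorph1 phi) R1 rmorph0 mul0r.
split=> // i j /=; rewrite mxE size_rcons nth_rcons ltnn eqxx; split=> //.
by rewrite [LHS]S0 [RHS]S0.
Qed.

(** * Interpolation between a shape and its transpose *)

Section Iterate.
Variables (R : pzRingType) (D : nat).
Hypothesis D_gt0 : (0 < D)%N.

(** A level of the recursion makes [D] recursive calls and three families of linear combinations.
    The bounds on the matrix sizes keep the latter below 6 D D^(j+1) operations, which the factor 2
    in [2 * D] absorbs. *)
Definition mul_power (j p q r : nat) :=
  mul_within R p q r ((6 * D).+1 * (2 * D) ^ j) /\
  [/\ (p * q <= D ^ j)%N, (q * r <= D ^ j)%N & (p * r <= D ^ j)%N].

Lemma mul_within1 : mul_within R 1 1 1 1.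
Proof.
exists (fun a b => Op Mul (a ord0 ord0) (b ord0 ord0) (fun c => Ret (const_mx c))).
split=> // S phi cphi s a b A B sa sb; split=> // i j.
rewrite /= mxE size_rcons nth_rcons ltnn eqxx; split=> //=.
have [[_ ->] [_ ->]] := (sa ord0 ord0, sb ord0 ord0).
by rewrite !ord1 mxE big_ord1.
Qed.

Lemma mul_power0 : mul_power 0 1 1 1.
Proof.
split=> //; exact: mul_within_le mul_within1.
Qed.

Lemma mul_powerS p q r j p' q' r' : rank_within R p q r D ->
  (p * q <= D)%N -> (q * r <= D)%N -> (p * r <= D)%N ->
  mul_power j p' q' r' -> mul_power j.+1 (p * p') (q * q') (r * r').
Proof.
move=> rk pq qr pr [Mj [pq' qr' pr']].
have le1 : (p * p' * (q * q') <= D ^ j.+1)%N by rewrite mulnACA expnS leq_mul.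
have le2 : (q * q' * (r * r') <= D ^ j.+1)%N by rewrite mulnACA expnS leq_mul.
have le3 : (p * p' * (r * r') <= D ^ j.+1)%N by rewrite mulnACA expnS leq_mul.
split=> //; apply: mul_within_le (mul_within_compose rk Mj) => //.
have leX : (D ^ j.+1 <= D * (2 * D) ^ j)%N.
  by rewrite expnS expnMn leq_mul // leq_pmull // expn_gt0.
have e1 : (p' * q' * (2 * (p * q)) = 2 * (p * p' * (q * q')))%N by lia.
have e2 : (q' * r' * (2 * (q * r)) = 2 * (q * q' * (r * r')))%N by lia.
rewrite e1 e2; move: le1 le2 le3 leX.
move: (p * p' * (q * q'))%N (q * q' * (r * r'))%N (p * p' * (r * r'))%N => x y z.
rewrite [((2 * D) ^ j.+1)%N]expnS; move: (D ^ j.+1)%N ((2 * D) ^ j)%N => X Y lx ly lz lX.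
nia.
Qed.

(** The levels of the recursion need not use the same shape: [k1] of them use the given
    decomposition and [k2] its transpose. *)
Lemma mul_power_mix p n k1 k2 : rank_within R p n n D -> (p <= n)%N ->
  (n * n <= D)%N ->
  mul_power (k1 + k2) (p ^ k1 * n ^ k2) (n ^ (k1 + k2)) (n ^ k1 * p ^ k2).
Proof.
move=> rk pn nn; have pnD : (p * n <= D)%N by apply: leq_trans nn; rewrite leq_mul2r pn orbT.
have npD : (n * p <= D)%N by rewrite mulnC.
elim: k1 => [|k1 IH].
  rewrite add0n !expn0 !mul1n; elim: k2 => [|k2 IH]; first exact: mul_power0.
  by rewrite !expnS; apply: mul_powerS => //; apply: rank_within_tr.
by rewrite addSn !expnS -!mulnA; apply: mul_powerS.
Qed.

End Iterate.

Section Interpolation.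
Variables (K : realType) (R : pzRingType).
Implicit Types (a b c x y s w e : K).

Lemma powR_natX (x : K) a k : 0 <= x -> (x ^+ k) `^ a = (x `^ a) ^+ k.
Proof.
move=> x0; elim: k => [|k IH]; first by rewrite !expr0 powR1.
by rewrite !exprS powRM ?exprn_ge0 // IH.
Qed.

Lemma powR_large (T e : K) : 0 < e -> exists2 n : nat, (1 < n)%N & T <= n%:R `^ e.
Proof.
move=> e0; pose t := Num.max T 1; have t1 : 1 <= t by rewrite le_max lexx orbT.
have t0 : 0 <= t by apply: le_trans t1.
exists (Num.Def.archi_bound (t `^ e^-1)).+2 => //.
apply: (@le_trans _ _ t); first by rewrite le_max lexx.
have et : t = (t `^ e^-1) `^ e by rewrite -powRrM mulVf ?powRr1 // lt0r_neq0.
rewrite [leLHS]et.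
apply: ge0_ler_powR; rewrite ?nnegrE ?powR_ge0 //; first exact: ltW.
apply: ltW; apply: (lt_le_trans (archi_boundP (powR_ge0 _ _))).
by rewrite ler_nat; lia.
Qed.

Lemma pow_dim_ge n a : n%:R `^ a <= (pow_dim n a)%:R :> K.
Proof.
rewrite /pow_dim; have := ceil_ge (n%:R `^ a); move/le_trans; apply.
rewrite natr_absz; rewrite ler_int ler_norm //.
Qed.

Lemma pow_dim_le n a (m : nat) : n%:R `^ a <= m%:R :> K -> (pow_dim n a <= m)%N.
Proof.
move=> le_m; rewrite /pow_dim -lez_nat gez0_abs ?ceil_le_int //.
by rewrite ceil_ge0 (lt_le_trans _ (powR_ge0 _ _)) // ltrN10.
Qed.

Lemma powR_ge1 n a : (0 < n)%N -> 0 <= a -> 1 <= n%:R `^ a :> K.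
Proof.
by move=> n0 a0; rewrite -[leLHS](powRr0 (n%:R : K)); apply: ler_powR; rewrite // ler1n.
Qed.

(** Rounding up adds less than 1, and the power itself is at least 1. *)
Lemma pow_dim_le2 n a : (0 < n)%N -> 0 <= a -> (pow_dim n a)%:R <= 2 * n%:R `^ a :> K.
Proof.
move=> n0 a0; rewrite /pow_dim natr_absz ger0_norm; last first.
  by rewrite ceil_ge0 (lt_le_trans _ (powR_ge0 _ _)) // ltrN10.
have := ceilB1_lt (n%:R `^ a : K); have := powR_ge1 n0 a0.
rewrite intrB; lra.
Qed.

Lemma pow_dim_mono n a b : (0 < n)%N -> a <= b -> (pow_dim n a <= pow_dim n b)%N.
Proof.
move=> n0 ab; apply: pow_dim_le; apply: le_trans (pow_dim_ge _ _).
by apply: ler_powR; rewrite // ler1n.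
Qed.

Lemma pow_dim1 n : pow_dim n (1 : K) = n.
Proof.
apply/eqP; rewrite eqn_leq pow_dim_le ?powRr1 //=.
by rewrite -(ler_nat K); have := pow_dim_ge n 1; rewrite powRr1.
Qed.

Definition rank_exponent s w := exists C : K, forall n, (0 < n)%N ->
  exists L, rank_within R (pow_dim n s) n n L /\ L%:R <= C * n%:R `^ w.

(* Mixing k1 copies of the shape <N^s, N, N> with k2 copies of its transpose
   covers every shape <M, n, p> with M p <= n^(1 + s), at the same cost. *)
Lemma mul_within_interpolation s w e c : 0 <= s <= 1 -> 2 <= w -> 0 < e ->
  rank_exponent s w ->
  exists C : K, forall n M p, (0 < n)%N -> (M <= n)%N -> (p <= n)%N ->
    M%:R * p%:R <= c * n%:R `^ (1 + s) ->
    exists L, mul_within R M n p L /\ L%:R <= C * n%:R `^ (w + e).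
Proof.
move=> /andP[s0 s1] w2 e0 [C0 HC0].
pose C1 := Num.max C0 1.
have C11 : 1 <= C1 by rewrite le_max lexx orbT.
(* [N] is so large that N^e absorbs both the constant of the rank bound and the factor 2 lost at
   each level, whence [2 * D] is at most N^(w + e). *)
have [N N1 HN] := powR_large (2 * C1) e0.
have N0 : (0 < N)%N by apply: ltnW.
have x1 : 1 <= N%:R :> K by rewrite ler1n.
have x0 : 0 <= N%:R :> K by [].
have [L [rkL leL]] := HC0 N N0.
(* [D] bounds the rank as well as the number of entries; since w is at least 2, including [N * N]
   does not spoil the bound C1 N^w. *)
pose P := pow_dim N s; pose D := maxn L (N * N).
have PN : (P <= N)%N by rewrite -[leqRHS](pow_dim1 N); apply: pow_dim_mono.
have rkD : rank_within R P N N D by apply: rank_within_leq rkL; apply: leq_maxl.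
have NND : (N * N <= D)%N by apply: leq_maxr.
have D0 : (0 < D)%N by apply: leq_trans NND; rewrite muln_gt0 N0.
pose y : K := N%:R `^ s; have y1 : 1 <= y by apply: powR_ge1.
have y0 : 0 <= y by apply: powR_ge0.
have yP : y <= P%:R by apply: pow_dim_ge.
have yx : y <= N%:R by rewrite -[leRHS]powRr1 //; apply: ler_powR.
have D2 : (2 * D)%:R <= N%:R `^ (w + e) :> K.
  rewrite powRD; last by apply/implyP => _; rewrite pnatr_eq0 -lt0n.
  have : D%:R <= C1 * N%:R `^ w :> K.
    rewrite /D natr_max ge_max; apply/andP; split.
      apply: le_trans leL _; apply: ler_wpM2r; first exact: powR_ge0.
      by rewrite le_max lexx.
    have : N%:R `^ 2 <= N%:R `^ w :> K by apply: ler_powR.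
    rewrite powR_mulrn // expr2 -natrM => /le_trans; apply.
    by rewrite -[leLHS]mul1r; apply: ler_wpM2r => //; exact: powR_ge0.
  move=> leD; rewrite natrM.
  apply: (@le_trans _ _ (2 * (C1 * N%:R `^ w))); first by rewrite ler_wpM2l.
  by rewrite mulrA [leRHS]mulrC; apply: ler_wpM2r => //; exact: powR_ge0.
(* [h] additional levels pay for the constant [c]. *)
have [h Hh] : exists h, Num.max c 1 <= N%:R ^+ h.
  exists (Num.Def.archi_bound (Num.max c 1)).
  apply: (@le_trans _ _ (2 ^+ (Num.Def.archi_bound (Num.max c 1)))).
    by apply: ltW; apply: upper_nthrootP.
  by apply: lerXn2r; rewrite ?nnegrE // ler_nat.
(* There will be k + h + 1 levels with N^k at most N n: the extra factor N and the h + 1 additional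
   levels give the exponent h + 2. *)
exists ((6 * D).+1%:R * (N%:R `^ (w + e)) ^+ (h.+2)).
move=> n M p n0 Mn pn leMp.
pose k := up_log N n; have nk : (n <= N ^ k)%N by apply: up_logP.
have kn : (N ^ k <= N * n)%N.
  have [n1|n1] := leqP n 1; last first.
    have := up_log_gtn N1 n1; have : (0 < k)%N by rewrite up_log_gt0 N1.
    by rewrite -/k; case: (k) => // k' _ /=; rewrite expnS => /ltnW; rewrite leq_pmul2l.
  have n_1 : n = 1%N by apply/eqP; rewrite eqn_leq n1.
  by rewrite /k n_1 up_log1 muln1.
have nkR : n%:R <= N%:R ^+ k :> K by rewrite -natrX ler_nat.
have leMp' : M%:R * p%:R <= N%:R ^+ h * (N%:R ^+ k * y ^+ k).
  apply: le_trans leMp _; apply: (@le_trans _ _ (N%:R ^+ h * n%:R `^ (1 + s))).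
    apply: ler_wpM2r; first exact: powR_ge0.
    by apply: le_trans Hh; rewrite le_max lexx.
  apply: ler_wpM2l; first exact: exprn_ge0.
  rewrite powRD; last by apply/implyP => _; rewrite pnatr_eq0 -lt0n.
  rewrite powRr1 // ler_pM ?powR_ge0 // -powR_natX //.
  by apply: ge0_ler_powR; rewrite ?nnegrE // exprn_ge0.
(* The least [k1] for which the columns fit is taken. Failure at k1 - 1 bounds [p] from below, so
   the bound on [M p] bounds [M] from above and the rows fit too. *)
pose Q k1 := (k1 <= k)%N && (p%:R <= N%:R ^+ k1 * y ^+ (k - k1)).
have exQ : exists k1, Q k1.
  exists k; rewrite /Q leqnn subnn expr0 mulr1 /=.
  by apply: le_trans nkR; rewrite ler_nat.
case: (ex_minnP exQ) => k1 /andP[k1k pk1] mink1.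
(* Besides the [h] levels for [c], one more makes up for [k1] being an integer. *)
pose k2 := (k - k1 + h.+1)%N.
have kk : (k1 + k2 = k + h.+1)%N by rewrite /k2 addnA subnKC.
have [MW _] := mul_power_mix D0 k1 k2 rkD PN NND.
have le_inner : (n <= N ^ (k1 + k2))%N.
  by apply: leq_trans nk _; rewrite leq_exp2l // kk leq_addr.
have le_cols : (p <= N ^ k1 * P ^ k2)%N.
  rewrite -(ler_nat K) natrM !natrX; apply: le_trans pk1 _.
  apply: ler_wpM2l; first exact: exprn_ge0.
  apply: (@le_trans _ _ (y ^+ k2)); last by apply: lerXn2r; rewrite ?nnegrE.
  by apply: ler_weXn2l => //; rewrite leq_addr.
have le_rows : (M <= P ^ k1 * N ^ k2)%N.
  case: k1 mink1 k1k pk1 @k2 kk MW le_inner le_cols => [|k1] mink1 k1k pk1 k2 kk MW _ _.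
    (* For k1 = 0 there is no lower bound on [p], but then the transposed levels alone already
       provide [n] rows. *)
    rewrite expn0 mul1n; apply: leq_trans Mn _; apply: leq_trans nk _.
    by rewrite leq_exp2l // /k2 subn0 leq_addr.
  have nQ : N%:R ^+ k1 * y ^+ (k - k1) < p%:R.
    rewrite ltNge; apply/negP => le_p.
    suff : (k1.+1 <= k1)%N by rewrite ltnn.
    by apply: mink1; rewrite /Q ltnW.
  rewrite -(ler_nat K) natrM !natrX.
  have z0 : 0 < N%:R ^+ k1 * y ^+ (k - k1).
    by rewrite mulr_gt0 // exprn_gt0 // (lt_le_trans ltr01).
  rewrite -(ler_pM2r z0).
  apply: (@le_trans _ _ (M%:R * p%:R)); first by rewrite ler_wpM2l // ltW.
  apply: le_trans leMp' _.
  have ek : k = (k1 + (k - k1))%N by rewrite subnKC // ltnW.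
  have ek2 : k2 = (k - k1 + h)%N by rewrite /k2 subnS addnS -addSn prednK // subn_gt0.
  have -> : y ^+ k = y ^+ k1 * y ^+ (k - k1) by rewrite -exprD -ek.
  have -> : N%:R ^+ k = N%:R ^+ k1 * N%:R ^+ (k - k1) :> K by rewrite -exprD -ek.
  rewrite ek2 exprD.
  have : y ^+ k1 <= P%:R ^+ k1.+1.
    apply: (@le_trans _ _ (y ^+ k1.+1)); first by apply: ler_weXn2l.
    by apply: lerXn2r; rewrite ?nnegrE.
  move: (exprn_ge0 h x0) (exprn_ge0 k1 x0) (exprn_ge0 (k - k1) x0) (exprn_ge0 (k - k1) y0).
  move: (N%:R ^+ h) (N%:R ^+ k1) (N%:R ^+ (k - k1)) (y ^+ (k - k1)) (y ^+ k1) (P%:R ^+ k1.+1).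
  move=> xh xk1 xk yk yk1 Pk xh0 xk10 xk0 yk0 le_yP.
  have -> : xh * (xk1 * xk * (yk1 * yk)) = yk1 * (xh * xk1 * xk * yk) by ring.
  have -> : Pk * (xk * xh) * (xk1 * yk) = Pk * (xh * xk1 * xk * yk) by ring.
  by apply: ler_wpM2r => //; rewrite !mulr_ge0.
exists ((6 * D).+1 * (2 * D) ^ (k1 + k2))%N; split.
  exact: mul_within_le le_rows le_inner le_cols _ MW.
rewrite natrM -mulrA ler_wpM2l // natrX kk.
set W := N%:R `^ (w + e); have W0 : 0 <= W by apply: powR_ge0.
apply: (@le_trans _ _ (W ^+ (k + h.+1))); first by apply: lerXn2r; rewrite ?nnegrE.
rewrite exprD mulrC [W ^+ h.+2]exprSr -mulrA ler_wpM2l ?exprn_ge0 //.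
rewrite -powR_natX // -powRM //.
apply: ge0_ler_powR; rewrite ?nnegrE ?exprn_ge0 ?mulr_ge0 //; first lra.
by rewrite -natrX -natrM ler_nat.
Qed.

End Interpolation.

(** * Exponents *)

(** A crude bound, from m^3 terms each combining m^2 entries; it serves only to show that some
    operation count and some exponent exist. *)
Lemma mul_within_naive (R : pzRingType) p q r m : (p <= m)%N -> (q <= m)%N ->
  (r <= m)%N -> mul_within R p q r (7 * m ^ 5).
Proof.
move=> pm qm rm; apply: (@mul_within_le R m m m (7 * m ^ 5)) => //.
have := mul_within_compose (rank_within_naive R m m m) (mul_within1 R).
rewrite !muln1 => /mul_within_le; apply=> //.
set L := (m * (m * m))%N; set Q := (m * m)%N.
have Lq : (L * Q = m ^ 5)%N by rewrite /L /Q; ring.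
have leL : (L <= m ^ 5)%N.
  by rewrite -Lq /L /Q; case: (m) => // k; rewrite leq_pmulr.
apply: (@leq_trans (6 * (L * Q) + L)); last by rewrite Lq; lia.
by move: L Q {Lq leL} => L Q; apply: eq_leq; ring.
Qed.

Section Exponents.
Variables (K : realType) (R : pzRingType).
Implicit Types (s w e c : K).

Definition mul_exponent (a b c w : K) := 0 <= w /\ exists C : K,
  forall n, (0 < n)%N -> exists L,
  mul_within R (pow_dim n a) (pow_dim n b) (pow_dim n c) L /\ L%:R <= C * n%:R `^ w.

(** The exponent [w0] shows that the set defining [omega] is nonempty; the infimum of the empty set
    is 0 by convention and would approximate nothing. *)
Lemma mul_exponent_lt_omega a b c e w0 : 0 < e -> mul_exponent a b c w0 ->
  exists2 w, mul_exponent a b c w & w < omega R a b c + e.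
Proof.
move=> e0 mw0; have : has_inf [set w | mul_exponent a b c w]%classic.
  by split; [exists w0|exists 0 => w []].
by move=> /(inf_adherent e0)[w mw lew]; exists w.
Qed.

Lemma mul_exponent_naive s : 0 <= s -> exists w, mul_exponent s 1 1 w.
Proof.
move=> s0; pose t := Num.max s 1; have t1 : 1 <= t by rewrite le_max lexx orbT.
exists (t * 5); split; first by rewrite mulr_ge0 // (le_trans _ t1).
exists (7 * 32) => n n0; pose m := pow_dim n t; exists (7 * m ^ 5)%N; split.
  by apply: mul_within_naive; apply: pow_dim_mono => //; rewrite le_max lexx.
rewrite natrM -mulrA ler_wpM2l // natrX powRrM -[5]/(5%:R) powR_mulrn ?powR_ge0 //.
have -> : 32 = 2 ^+ 5 :> K by rewrite -natrX.
rewrite -exprMn; apply: lerXn2r; rewrite ?nnegrE ?mulr_ge0 ?powR_ge0 //.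
by apply: pow_dim_le2 => //; apply: le_trans t1.
Qed.

Lemma rank_exponent_le s s' w : s' <= s -> rank_exponent R s w ->
  rank_exponent R s' w.
Proof.
move=> ss' [C HC]; exists C => n n0; have [L [rk leL]] := HC n n0.
exists L; split=> //; apply: rank_within_le rk => //.
exact: pow_dim_mono.
Qed.

Lemma rank_exponent_mulP s w : mul_exponent s 1 1 w -> rank_exponent R s w.
Proof.
move=> [_ [C HC]]; exists C => n n0; have [L [mL leL]] := HC n n0.
by exists L; split=> //; move/mul_within_rank: mL; rewrite !pow_dim1.
Qed.

Lemma rank_exponent_mulP_tr s w : mul_exponent 1 1 s w -> rank_exponent R s w.
Proof.
move=> [_ [C HC]]; exists C => n n0; have [L [mL leL]] := HC n n0.
by exists L; split=> //; move/mul_within_rank/rank_within_tr: mL; rewrite !pow_dim1.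
Qed.

Lemma rank_exponent_weaken s w w' : w <= w' -> rank_exponent R s w ->
  rank_exponent R s w'.
Proof.
move=> ww' [C HC]; exists (Num.max C 0) => n n0; have [L [rk leL]] := HC n n0.
exists L; split=> //; apply: le_trans leL _.
apply: (@le_trans _ _ (Num.max C 0 * n%:R `^ w)).
  by apply: ler_wpM2r; rewrite ?powR_ge0 // le_max lexx.
by apply: ler_wpM2l; [rewrite le_max lexx orbT|apply: ler_powR; rewrite // ler1n].
Qed.

(** The rank of <N^s, N, N> is at least N^2, so for w < 2 the unbounded power N^(2 - w) would stay
    below [C]. *)
Lemma rank_exponent_ge2 s w : (1 : R) != 0 -> 0 <= s -> rank_exponent R s w -> 2 <= w.
Proof.
move=> R1 s0 [C HC]; rewrite leNgt; apply/negP => w2.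
have e0 : 0 < 2 - w by lra.
have [N N1 HN] := powR_large (C + 1) e0.
have N0 : (0 < N)%N by apply: ltnW.
have [L [rk leL]] := HC N N0.
have NL : (N * N <= L)%N.
  apply: rank_within_ge rk => //.
  by rewrite -(ltr_nat K); apply: lt_le_trans (pow_dim_ge _ _); rewrite powR_gt0 // ltr0n.
have W0 : 0 < N%:R `^ w :> K by rewrite powR_gt0 // ltr0n.
have : (C + 1) * N%:R `^ w <= C * N%:R `^ w.
  apply: (@le_trans _ _ (N%:R `^ 2)).
    have -> : N%:R `^ 2 = N%:R `^ (2 - w) * N%:R `^ w :> K.
      rewrite -powRD; first by congr (_ `^ _); lra.
      by apply/implyP => _; rewrite pnatr_eq0 -lt0n.
    by rewrite ler_pM2r.
  rewrite -[2]/(2%:R) powR_mulrn // expr2 -natrM; apply: le_trans leL.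
  by rewrite ler_nat.
by rewrite ler_pM2r //; lra.
Qed.

(** The bound has to be available for every [c], because in the application this constant depends on
    those of the sensing scheme and of the sparsity assumption. *)
Definition cheap_products s v := forall c, exists C : K, forall n M p,
  (0 < n)%N -> (M <= n)%N -> (p <= n)%N -> M%:R * p%:R <= c * n%:R `^ s ->
  exists L, mul_within R M n p L /\ L%:R <= C * n%:R `^ v.

(** Interpolation requires an exponent of at most 1. For larger [s] the exponent 1 suffices, since
    [M p] never exceeds n^2. *)
Lemma cheap_products_rank s w e : 0 < s -> 2 <= w -> 0 < e ->
  rank_exponent R (Num.min s 1) w -> cheap_products (1 + s) (w + e).
Proof.
move=> s0 w2 e0 rk c.
have s1 : 0 <= Num.min s 1 <= 1 by rewrite le_min ge_min lexx (ltW s0) orbT ler01.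
have [C HC] := mul_within_interpolation (Num.max c 1) s1 w2 e0 rk.
exists C => n M p n0 Mn pn leMp; apply: HC => //.
have [s_le1|s_gt1] := lerP s 1.
  apply: le_trans leMp _; apply: ler_wpM2r; first exact: powR_ge0.
  by rewrite le_max lexx.
apply: (@le_trans _ _ (1 * n%:R ^+ 2)).
  by rewrite mul1r expr2 -!natrM ler_nat leq_mul.
apply: ler_pM; rewrite ?exprn_ge0 //; first by rewrite le_max lexx orbT.
by rewrite -powR_mulrn //; have -> : 1 + 1 = 2%:R :> K by [].
Qed.

(** The shape <1, n, n> has rank at most n^2, which is the case of exponent 0 in the
    interpolation. *)
Lemma cheap_products_small s e : s <= 1 -> 0 < e -> cheap_products s (2 + e).
Proof.
move=> s1 e0 c.
have rk : rank_exponent R (0 : K) 2.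
  exists 1 => n n0; exists (1 * (n * n))%N; split.
    have -> : pow_dim n (0 : K) = 1%N by rewrite /pow_dim powRr0 ceil1.
    exact: rank_within_naive.
  by rewrite mul1n mul1r natrM -expr2 -[X in _ `^ X]/(2%:R) powR_mulrn.
have s01 : 0 <= (0 : K) <= 1 by rewrite lexx ler01.
have [C HC] := mul_within_interpolation (Num.max c 0) s01 (lexx 2) e0 rk.
exists C => n M p n0 Mn pn leMp; apply: HC => //; rewrite addr0.
apply: le_trans leMp _; apply: (@le_trans _ _ (Num.max c 0 * n%:R `^ s)).
  by apply: ler_wpM2r; rewrite ?powR_ge0 // le_max lexx.
by apply: ler_wpM2l; [rewrite le_max lexx orbT|apply: ler_powR; rewrite // ler1n].
Qed.

(* Enlarging n to n^(1 + e) trades an excess e in the product M p for a factor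
   1 + e in the exponent. *)
Lemma cheap_products_slack s w e : 0 < e -> 1 <= s -> 0 <= w ->
  cheap_products s w -> cheap_products (s + e) ((1 + e) * w).
Proof.
move=> e0 s1 w0 cp c.
have [C HC] := cp (Num.max c 0).
exists (Num.max C 0 * 2 `^ w) => n M p n0 Mn pn leMp.
pose n' := pow_dim n (1 + e).
have nn' : (n <= n')%N by rewrite -[leqLHS](pow_dim1 K); apply: pow_dim_mono => //; lra.
have n'0 : (0 < n')%N by apply: leq_trans nn'.
have [] := HC n' M p n'0 (leq_trans Mn nn') (leq_trans pn nn').
  apply: le_trans leMp _; apply: (@le_trans _ _ (Num.max c 0 * n%:R `^ (s + e))).
    by apply: ler_wpM2r; rewrite ?powR_ge0 // le_max lexx.
  apply: ler_wpM2l; first by rewrite le_max lexx orbT.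
  apply: (@le_trans _ _ (n%:R `^ ((1 + e) * s))).
    by apply: ler_powR; [rewrite ler1n|nra].
  rewrite powRrM; apply: ge0_ler_powR; rewrite ?nnegrE ?powR_ge0 //; first lra.
  exact: pow_dim_ge.
move=> L [mL leL]; exists L; split; first exact: mul_within_le mL.
apply: le_trans leL _; apply: (@le_trans _ _ (Num.max C 0 * n'%:R `^ w)).
  by apply: ler_wpM2r; rewrite ?powR_ge0 // le_max lexx.
rewrite -mulrA; apply: ler_wpM2l; first by rewrite le_max lexx orbT.
rewrite powRrM -powRM ?powR_ge0 //.
apply: ge0_ler_powR; rewrite ?nnegrE ?mulr_ge0 ?powR_ge0 //.
by apply: pow_dim_le2 => //; lra.
Qed.

Lemma cheap_products_weaken s v s' v' : s' <= s -> v <= v' ->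
  cheap_products s v -> cheap_products s' v'.
Proof.
move=> ss' vv' cp c; have [C HC] := cp (Num.max c 0).
exists (Num.max C 0) => n M p n0 Mn pn leMp; have [] := HC n M p n0 Mn pn.
  apply: le_trans leMp _; apply: (@le_trans _ _ (Num.max c 0 * n%:R `^ s')).
    by apply: ler_wpM2r; rewrite ?powR_ge0 // le_max lexx.
  by apply: ler_wpM2l; [rewrite le_max lexx orbT|apply: ler_powR; rewrite // ler1n].
move=> L [mL leL]; exists L; split=> //.
apply: le_trans leL _; apply: (@le_trans _ _ (Num.max C 0 * n%:R `^ v)).
  by apply: ler_wpM2r; rewrite ?powR_ge0 // le_max lexx.
by apply: ler_wpM2l; [rewrite le_max lexx orbT|apply: ler_powR; rewrite // ler1n].
Qed.

(** The supremum need not be attained, so some [w0] within [h] of it is used, and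
    [cheap_products_slack] recovers the missing [h]. *)
Lemma cheap_products_perp s e : 1 < s -> s <= 1 + omega_perp R K -> 0 < e ->
  cheap_products s (2 + e).
Proof.
move=> s1 s_perp e0.
pose E := [set w : K | 0 <= w /\ omega R 1 1 w = 2]%classic.
(* Otherwise the supremum would have its default value 0, against 1 < s. *)
have supE : has_sup E.
  apply: contrapT => /sup_out supE0.
  by move: s_perp; rewrite /omega_perp -/E supE0; lra.
(* The final exponent (1 + h)(2 + 2h) is at most 2 + 6h, as h is at most 1, hence below 2 + e; the
   last bound on [h] keeps s - 1 - h positive. *)
pose h := Num.min (Num.min 1 (e / 8)) ((s - 1) / 2).
have h0 : 0 < h by rewrite !lt_min ltr01 divr_gt0 // divr_gt0 // subr_gt0.
have h1 : h <= 1 by rewrite !ge_min lexx.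
have he : h <= e / 8 by rewrite !ge_min lexx orbT.
have hs : h <= (s - 1) / 2 by rewrite !ge_min lexx orbT.
have [w0 [w00 w0E] w0s] := sup_adherent h0 supE.
have [w mw w2] : exists2 w, mul_exponent 1 1 w0 w & w < 2 + h.
  have [[w1 mw1]|no] := pselect (exists w, mul_exponent 1 1 w0 w).
    by rewrite -w0E; apply: mul_exponent_lt_omega mw1.
  (* Without any admissible exponent the infimum would be 0 rather than 2. *)
  suff : omega R 1 1 w0 = 0 by rewrite w0E => /eqP; rewrite pnatr_eq0.
  by apply: inf_out => -[[w mw] _]; apply: no; exists w.
have sh : 0 < s - 1 - h by lra.
have rk : rank_exponent R (Num.min (s - 1 - h) 1) (2 + h).
  apply: (@rank_exponent_le (s - 1 - h)); first by rewrite ge_min lexx.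
  apply: (@rank_exponent_le w0).
    by move: s_perp w0s; rewrite /omega_perp -/E; lra.
  by apply: rank_exponent_weaken (rank_exponent_mulP_tr mw); apply: ltW.
have w2' : 2 <= 2 + h by lra.
have cp := cheap_products_rank sh w2' h0 rk.
have cp' := cheap_products_slack h0 _ _ cp.
apply: cheap_products_weaken (cp' _ _).
- lra.
- nra.
- lra.
- lra.
Qed.

Lemma cheap_products_omega s e : 1 < s -> 0 < e -> (1 : R) != 0 ->
  cheap_products s (omega R (s - 1) 1 1 + e).
Proof.
move=> s1 e0 R1; have s0 : 0 < s - 1 by lra.
have [w0 mw0] := mul_exponent_naive (ltW s0).
have e2 : 0 < e / 2 by lra.
have [w mw lew] := mul_exponent_lt_omega e2 mw0.
have rk := rank_exponent_mulP mw.
have w2 := rank_exponent_ge2 R1 (ltW s0) rk.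
have rk1 : rank_exponent R (Num.min (s - 1) 1) w.
  by apply: rank_exponent_le rk; rewrite ge_min lexx.
by apply: cheap_products_weaken (cheap_products_rank s0 w2 e2 rk1); lra.
Qed.

Lemma cheap_products_beta s e : 0 < e ->
  cheap_products s
    ((if s <= 1 + omega_perp R K then 2 else omega R (s - 1) 1 1) + e).
Proof.
move=> e0.
(* The zero ring violates the rank lower bound, but there products cost nothing. *)
have [R0|R1] := eqVneq (1 : R) 0.
  move=> c; exists 0 => n M p _ _ _ _; exists 0%N.
  by split; [apply: mul_within_trivial|rewrite mul0r].
have perp0 : 0 <= omega_perp R K.
  rewrite /omega_perp; set E := [set w | _]%classic.
  have [supE|/sup_out->//] := pselect (has_sup E).
  have [w [w0 wE]] := supE.1.
  by apply: (le_trans w0); apply: ub_le_sup; [case: supE|split].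
have [s1|s1] := lerP s 1.
  by rewrite ifT; [apply: cheap_products_small|lra].
case: ifP => s_perp; first exact: cheap_products_perp.
exact: cheap_products_omega.
Qed.

End Exponents.

(** * Correctness of Algorithm 2 *)

Section NonZeros.
Variable R : pzRingType.

Lemma nnz_sum m n (M : 'M[R]_(m, n)) : nnz M = (\sum_j \sum_i (M i j != 0%R))%N.
Proof.
rewrite /nnz -sum1_card big_mkcond /= exchange_big pair_bigA /=.
by apply: eq_bigr => -[i j] _; rewrite inE; case: eqP.
Qed.

Lemma nnz_col m n (M : 'M[R]_(m, n)) j : nnz (col j M) = (\sum_i (M i j != 0%R))%N.
Proof. by rewrite nnz_sum big_ord1; apply: eq_bigr => i _; rewrite mxE. Qed.

Lemma nnz_col_le m n (M : 'M[R]_(m, n)) j : (nnz (col j M) <= m)%N.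
Proof.
rewrite nnz_col -[leqRHS]card_ord -sum1_card; apply: leq_sum => i _.
exact: leq_b1.
Qed.

Lemma nnz_eq0 m n (M : 'M[R]_(m, n)) : (nnz M == 0%N) = (M == 0).
Proof.
rewrite cards_eq0; apply/eqP/eqP => [M0|->].
  apply/matrixP => i j; apply/eqP; have /setP/(_ (i, j)) := M0.
  by rewrite !inE mxE => /negbFE.
by apply/setP => -[i j]; rewrite !inE mxE eqxx.
Qed.

Lemma leq_card_nnz n p (M : 'M[R]_(n, p)) (I : finType) (L : {set I}) (f : I -> 'I_p) w :
  injective f -> (forall l, l \in L -> (w <= nnz (col (f l) M))%N) ->
  (#|L| * w <= nnz M)%N.
Proof.
move=> f_inj le_w; rewrite -sum_nat_const nnz_sum.
apply: (@leq_trans (\sum_(l in L) nnz (col (f l) M))); first exact: leq_sum.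
rewrite -(big_imset (fun j => nnz (col j M))) /=; last by move=> x y _ _ /f_inj.
rewrite big_mkcond /=; apply: leq_sum => j _.
by case: ifP => // _; rewrite nnz_col.
Qed.

End NonZeros.

Lemma spec_forM (K : Type) (S : pzRingType) (phi : K -> S) timed X
    (f : nat -> X -> prog K X) (Inv : nat -> seq S -> X -> Prop) i0 len c s x :
  (forall i s x, (i0 <= i < i0 + len)%N -> Inv i s x ->
     spec phi timed (f i x) s (Inv i.+1) c) ->
  Inv i0 s x ->
  spec phi timed (forM (iota i0 len) f x) s (Inv (i0 + len)%N) (len * c).
Proof.
elim: len i0 s x => [|len IH] i0 s x Hf Inv0 /=.
  by rewrite addn0; apply: spec_ret.
rewrite mulSn; apply: spec_bind; first by apply: Hf => //; lia.
by move=> s' y _ Invy; rewrite -addSnnS; apply: IH => // i s1 y1 lei; apply: Hf; lia.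
Qed.

Section Algorithm2.
Variables (R : pzRingType) (m : nat -> nat -> nat).
Variables (H : forall n t : nat, 'M[R]_(m n t, n)) (MR : cs_pair R m).
Variable V : col_mmv_alg R.
Hypothesis scheme : cs_scheme H MR.
Hypothesis mmv : column_wise_mmv V.

Definition correct_off (n : nat) (C : 'M[R]_n) (s : seq R)
    (st : {set 'I_n} * 'M[nat]_n) :=
  forall j, j \notin st.1 -> forall k, stores s (st.2 k j) (C k j).

(** Nothing is known before round 0. After the last round 2^(i - 1) is at least n, so the threshold
    is n and no column can remain. *)
Definition heavy n (C : 'M[R]_n) (i : nat) (J : {set 'I_n}) :=
  forall j, j \in J -> i = 0%N \/ (minn (2 ^ i.-1) n < nnz (col j C))%N.

(** The running times are assumed only if [timed] holds, so that the same statement yields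
    correctness for every product subroutine and the cost for a particular one. *)
Lemma spec_alg2_step (P : product_alg R m) (timed : bool) n (A B : 'M[R]_n)
    (a b : 'M[nat]_n) i (J : {set 'I_n}) (c : 'M[nat]_n) s
    (cM cP cR cV : nat) : (0 < n)%N ->
  let t := minn (2 ^ i) n in
  (timed -> forall s, (ops (exec (sensing MR n t) s) <= cM)%N) ->
  (forall s aH a b, holds s aH (H n t) -> holds s a A ->
     holds s b (colsub (fun l : 'I_#|J| => enum_val l) B) ->
     spec idfun timed (P n t #|J| aH a b) s (fun s' d => holds s' d
       (H n t *m A *m colsub (fun l : 'I_#|J| => enum_val l) B)) cP) ->
  (timed -> forall s a y, holds s a y ->
     (ops (exec (recovery MR n t a) s) <= cR)%N) ->
  (timed -> forall s a b c (B' C' : 'M[R]_(n, #|J|)),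
     holds s a A -> holds s b B' -> holds s c C' ->
     (ops (exec (V a b c) s) <= cV)%N) ->
  holds s a A -> holds s b B -> correct_off (A *m B) s (J, c) ->
  spec idfun timed (alg2_step MR V P a b i (J, c)) s
    (fun s' st => correct_off (A *m B) s' st /\ heavy (A *m B) i.+1 st.1)
    (cM + (cP + (#|J| * cR + (cV + 0)))).
Proof.
move=> n0 t timeM specP timeR timeV sa sb sc.
have t_range : (1 <= t <= n)%N by rewrite leq_min expn_gt0 n0 geq_minr.
have [_ /(_ n t t_range)[sensingH recoverH recover_any]] := scheme.
pose e (l : 'I_#|J|) := enum_val l; pose B' := colsub e B.
have colE l : col l (A *m B') = col (e l) (A *m B).
  by apply/matrixP => k z; rewrite !mxE; apply: eq_bigr => j _; rewrite mxE.
rewrite /alg2_step -/t.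
apply: (spec_bind (Q := fun s' aH => holds s' aH (H n t))).
  by split; [apply: sensingH|apply/implyP => tm; apply: timeM].
move=> s1 aH ss1 saH; apply: spec_bind.
  apply: specP => //; first exact: holds_prefix ss1 sa.
  by move=> k l; rewrite !mxE; apply: stores_prefix ss1 (sb k (e l)).
move=> s2 d s12 sd; have ss2 := prefix_trans ss1 s12.
have sdl l : holds s2 (col l d) (H n t *m col l (A *m B')).
  have -> : H n t *m col l (A *m B') = col l (H n t *m A *m B').
    apply/matrixP => k z; rewrite -mulmxA !mxE.
    by apply: eq_bigr => j _; rewrite !mxE.
  by move=> k z; rewrite [col l d k z]mxE [col l _ k z]mxE; apply: sd.
(* A column that is not sparse yields an arbitrary but well-defined vector, as [V] needs a genuine
   matrix to compare with; wrong columns are then detected. *)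
apply: (spec_bind (Q := fun s' f => forall l, exists x : 'cV_n,
    holds s' (col l f) x /\ (sparse t (col l (A *m B')) -> x = col l (A *m B')))).
  apply: (@spec_for_cols _ _ _ _ _ _ _ _ (fun l s' f => exists x : 'cV_n,
    holds s' f x /\ (sparse t (col l (A *m B')) -> x = col l (A *m B')))).
    move=> l s3 s4 f s34 [x [sx xE]]; exists x; split=> //.
    exact: holds_prefix s34 sx.
  move=> l s' s2'; have sdl' := holds_prefix s2' (sdl l); split.
    have [sp|nsp] := boolP (sparse t (col l (A *m B'))).
      by exists (col l (A *m B')); split=> //; apply: recoverH.
    by have [x sx] := recover_any _ _ _ sdl'; exists x.
  by apply/implyP => tm; apply: timeR sdl'.
move=> s3 f s23 /choice[x Hx]; have ss3 := prefix_trans ss2 s23.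
pose F : 'M[R]_(n, #|J|) := \matrix_(k, l) x l k ord0.
have FE l : col l F = x l by apply/matrixP => k z; rewrite !mxE (ord1 z).
have sf : holds s3 f F.
  by move=> k l; have [/(_ k ord0)] := Hx l; rewrite !mxE.
have sb3 : holds s3 (colsub e b) B'.
  by move=> k l; rewrite !mxE; apply: stores_prefix ss3 (sb k (e l)).
have sa3 := holds_prefix ss3 sa.
apply: (spec_bind (Q := fun s' L => prefix s3 s' /\
    L = [set l | col l (A *m B') != col l F]%SET)).
  split; first by split; [apply: prefix_run|apply: mmv].
  by apply/implyP => tm; apply: timeV sa3 sb3 sf.
move=> s4 L s34 [_ LE]; apply: spec_ret; split=> [j|j] /=.
  move=> jJ' k; rewrite mxE; case: pickP => [l /andP[/eqP <- lL]|nol].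
    move: lL; rewrite LE inE negbK => /eqP El.
    have := stores_prefix s34 (sf k l).
    have -> // : F k l = (A *m B) k (e l).
    by move/matrixP: El => /(_ k ord0); rewrite colE !mxE.
  apply: stores_prefix (prefix_trans ss3 s34) (sc j _ k).
  apply/negP => jJ; have := nol (enum_rank_in jJ j).
  rewrite enum_rankK_in // eqxx /= => /negbFE lL.
  case/imsetP: jJ'; exists (enum_rank_in jJ j) => //.
  by rewrite enum_rankK_in.
(* A column is kept only if recovery failed on it, hence only if it is not t-sparse. *)
move=> /imsetP[l]; rewrite LE inE FE colE => lL ->; right.
rewrite ltnNge; apply/negP => le_t; case/eqP: lL.
by have [_] := Hx l; rewrite colE => ->.
Qed.

Lemma spec_alg2 (P : product_alg R m) (timed : bool) n (A B : 'M[R]_n) a b c s T :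
  (0 < n)%N ->
  (forall i J c s, (i <= up_log 2 n)%N -> holds s a A -> holds s b B ->
     correct_off (A *m B) s (J, c) -> heavy (A *m B) i J ->
     spec idfun timed (alg2_step MR V P a b i (J, c)) s
       (fun s' st => correct_off (A *m B) s' st /\ heavy (A *m B) i.+1 st.1) T) ->
  holds s a A -> holds s b B ->
  spec idfun timed (alg2 MR V P a b c) s (fun s' d => holds s' d (A *m B))
    ((up_log 2 n).+1 * T).
Proof.
move=> n0 step sa sb; rewrite -[((up_log 2 n).+1 * T)%N]addn0.
pose Inv i s' st := [/\ holds s' a A, holds s' b B,
  correct_off (A *m B) s' st & heavy (A *m B) i st.1].
apply: (spec_bind (Q := Inv (0 + (up_log 2 n).+1)%N)).
  apply: spec_forM => [i s' [J c'] /andP[_ lei] [sa' sb' co he]|]; last first.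
    by split=> // [j|j _]; [rewrite inE|left].
  apply: spec_weaken (step _ _ _ _ _ sa' sb' co he) (leqnn _) _ => //.
  by move=> s'' st s'_ [co' he']; split=> //; [apply: holds_prefix s'_ sa'|
    apply: holds_prefix s'_ sb'].
move=> s' [J c'] _ [_ _ co he]; apply: spec_ret => k j; apply: co => /=.
apply/negP => /he[] //; rewrite add0n /= (minn_idPr (up_logP n _)) //.
by rewrite ltnNge nnz_col_le.
Qed.

Lemma alg2_correct (P : product_alg R m) : correct_product H P ->
  forall n (A B : 'M[R]_n) s a b c, holds s a A -> holds s b B ->
  computes s (alg2 MR V P a b c) (A *m B).
Proof.
move=> corP n A B s a b c sa sb.
case: (posnP n) => [n0|n0]; first by move=> i; have := ltn_ord i; rewrite {2}n0.
have [] // := @spec_alg2 P false n A B a b c s 0 n0 _ sa sb.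
move=> i J c' s' _ sa' sb' co _.
apply: spec_weaken (spec_alg2_step (cM := 0) (cP := 0) (cR := 0) (cV := 0)
  n0 _ _ _ _ sa' sb' co) _ _ => //.
  by move=> s1 aH a1 b1 saH sa1 sb1; split=> //; apply: corP => //;
    rewrite leq_min expn_gt0 n0 geq_minr.
by rewrite muln0.
Qed.

End Algorithm2.

(** * The cost of Algorithm 2 *)

(** A program of minimal operation count meets every bound at once, so the product subroutine can be
    fixed before [delta] and [eps] are known. *)
Lemma cheapest_product (R : pzRingType) p q r :
  { P : 'M[nat]_(p, q) -> 'M[nat]_(q, r) -> prog R 'M[nat]_(p, r) |
    forall L, mul_within R p q r L -> forall s a b (A : 'M[R]_(p, q)) B,
      holds s a A -> holds s b B ->
      spec idfun true (P a b) s (fun s' c => holds s' c (A *m B)) L }.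
Proof.
apply: cid.
have ex : exists L, `[< mul_within R p q r L >].
  exists (7 * maxn p (maxn q r) ^ 5)%N; apply/asboolP.
  by apply: mul_within_naive; rewrite !leq_max leqnn ?orbT.
case: (ex_minnP ex) => L0 /asboolP[P [_ specP]] minL.
exists P => L /asboolP/minL le_L s a b A B sa sb.
have [out le_ops] := specP R idfun (fun _ cc => cc) s a b A B sa sb.
by split=> //=; apply: leq_trans le_L.
Qed.

(** * Evaluation of the product of H, A and B' *)

Section Product.
Variables (R : pzRingType) (m : nat -> nat -> nat).
Variables (H : forall n t : nat, 'M[R]_(m n t, n)) (V : col_mmv_alg R).
Hypothesis mmv : column_wise_mmv V.
Variables (TH : nat -> nat -> nat) (TV : nat -> nat -> nat -> nat).
Hypothesis timeV : col_mmv_time V TV.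
Variable PH : forall n t,
  'M[nat]_(m n t, n) -> 'M[nat]_n -> prog R 'M[nat]_(m n t, n).
Hypothesis spec_PH : forall n t, (1 <= t <= n)%N ->
  forall s aH aX X, holds s aH (H n t) -> holds s aX X ->
    spec idfun true (PH aH aX) s (fun s' d => holds s' d (H n t *m X)) (TH n t).

Definition best p q r := sval (cheapest_product R p q r).
Definition spec_best p q r := svalP (cheapest_product R p q r).

(* When H has more than n rows, H (A B) is cheaper than (H A) B. *)
Definition dense_product n t q (aH : 'M[nat]_(m n t, n)) (a : 'M[nat]_n)
    (b : 'M[nat]_(n, q)) : prog R 'M[nat]_(m n t, q) :=
  if (m n t <= n)%N || (n < q)%N then
    let! ha := PH aH a in best ha b
  else
    let! c := best a b in
    let! z := Cst 0 Ret in
    let! d := PH aH (\matrix_(k, j) if insub (val j) is Some l then c k l else z) in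
    Ret (\matrix_(k, l) if insub (val l) is Some j then d k j else z).

(** The time for multiplying by H refers to n x n matrices, so [A *m B] is padded with zero columns.
    This needs q at most n, hence the second disjunct of the test. *)
Lemma spec_dense_product n t q s aH a b (A : 'M[R]_n) (B : 'M[R]_(n, q)) L :
  (1 <= t <= n)%N ->
  mul_within R (if (m n t <= n)%N || (n < q)%N then m n t else n) n q L ->
  holds s aH (H n t) -> holds s a A -> holds s b B ->
  spec idfun true (dense_product aH a b) s
    (fun s' d => holds s' d (H n t *m A *m B)) (TH n t + L).
Proof.
move=> t_range + sH sa sb; rewrite /dense_product; case: ifP => [_|] mul_L.
  apply: spec_bind; first exact: spec_PH sH sa.
  by move=> s1 ha ss1 sha; apply: spec_best sha (holds_prefix ss1 sb).
move=> /spec_best best_L; have qn : (q <= n)%N.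
  by move/negbT: mul_L; rewrite negb_or -leqNgt => /andP[].
pose pad : 'M[R]_n := \matrix_(k, j) if insub (val j) is Some l then (A *m B) k l else 0.
have -> : (TH n t + L = L + (0 + (TH n t + 0)))%N by rewrite addn0 add0n addnC.
apply: spec_bind; first exact: best_L sa sb.
move=> s1 c ss1 sc; apply: spec_bind; first exact: spec_cst.
move=> s2 z s12 sz; apply: spec_bind.
  apply: (spec_PH (X := pad) t_range).
    exact: holds_prefix (prefix_trans ss1 s12) sH.
  move=> k j; rewrite !mxE; case: insubP => // l _ _.
  exact: stores_prefix s12 (sc k l).
move=> s3 d s23 sd; apply: spec_ret => k l; rewrite mxE.
rewrite (insubT (fun i => (i < n)%N) (leq_trans (ltn_ord l) qn)).
suff -> : (H n t *m A *m B) k l =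
    (H n t *m pad) k (Sub (val l) (leq_trans (ltn_ord l) qn)) by apply: sd.
rewrite -mulmxA [LHS]mxE [RHS]mxE; apply: eq_bigr => j _; congr (_ * _).
by rewrite [RHS]mxE /= insubT //= => ltl; congr (_ j _); apply: val_inj.
Qed.

(* Restricting to the nonzero columns of A B makes the cost depend on the
   sparsity of the product even when t = 1, before any column is discarded. *)
Definition sparse_product : product_alg R m := fun n t p aH a b =>
  let! z := Cst 0 Ret in
  let! L := V a b (const_mx z) in
  let! d := dense_product aH a (colsub (fun l : 'I_#|L| => enum_val l) b) in
  Ret (\matrix_(k, j)
    if [pick l : 'I_#|L| | enum_val l == j] is Some l then d k l else z).

Lemma spec_sparse_product n t p s aH a b (A : 'M[R]_n) (B : 'M[R]_(n, p)) L :
  let q := #|[set j | col j (A *m B) != 0]%SET| in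
  (1 <= t <= n)%N ->
  mul_within R (if (m n t <= n)%N || (n < q)%N then m n t else n) n q L ->
  holds s aH (H n t) -> holds s a A -> holds s b B ->
  spec idfun true (sparse_product aH a b) s
    (fun s' d => holds s' d (H n t *m A *m B)) (TV n n p + (TH n t + L)).
Proof.
move=> q t_range mul_L sH sa sb.
have -> : (TV n n p + (TH n t + L) = 0 + (TV n n p + (TH n t + L + 0)))%N.
  by rewrite addn0.
apply: spec_bind; first exact: spec_cst.
move=> s1 z ss1 sz.
have s0 : holds s1 (const_mx z) (0 : 'M[R]_(n, p)) by move=> k j; rewrite !mxE.
apply: (spec_bind (Q := fun s' J => prefix s1 s' /\
    J = [set j | col j (A *m B) != 0]%SET)).
  split; last by apply: timeV (holds_prefix ss1 sa) (holds_prefix ss1 sb) s0.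
  split; first exact: prefix_run.
  rewrite (mmv (holds_prefix ss1 sa) (holds_prefix ss1 sb) s0).
  by apply/setP => j; rewrite !inE; congr (_ != _); apply/matrixP => k l; rewrite !mxE.
move=> s2 J s12 [_ JE]; have ss2 := prefix_trans ss1 s12.
pose B' := colsub (fun l : 'I_#|J| => enum_val l) B.
apply: spec_bind.
  apply: (spec_dense_product (B := B') (L := L) t_range).
  - by rewrite JE.
  - exact: holds_prefix ss2 sH.
  - exact: holds_prefix ss2 sa.
  - by move=> k l; rewrite !mxE; apply: stores_prefix ss2 (sb _ _).
move=> s3 d s23 sd; apply: spec_ret => k j; rewrite [X in (X < _)%N]mxE [X in _`_X]mxE.
case: pickP => [l /eqP <-|nol].
  suff -> : (H n t *m A *m B) k (enum_val l) = (H n t *m A *m B') k l by apply: sd.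
  by rewrite !mxE; apply: eq_bigr => i _; rewrite [B' _ _]mxE.
(* A column outside [J] is zero in [A *m B], hence in the result, where the address [z] of 0 stands
   for it. *)
have jJ : j \notin J.
  by apply/negP => jJ; have := nol (enum_rank_in jJ j); rewrite enum_rankK_in // eqxx.
have -> : (H n t *m A *m B) k j = 0.
  move: jJ; rewrite JE inE negbK => /eqP/matrixP AB0.
  rewrite -mulmxA mxE big1 // => i _.
  by have := AB0 i ord0; rewrite [col _ _ _ _]mxE => ->; rewrite mxE mulr0.
exact: stores_prefix s23 (stores_prefix s12 sz).
Qed.

Lemma sparse_product_correct : correct_product H sparse_product.
Proof.
move=> n t p s aH a b A B t_range sH sa sb.
have naive p' q' r' : mul_within R p' q' r' (7 * maxn p' (maxn q' r') ^ 5).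
  by apply: mul_within_naive; rewrite !leq_max leqnn ?orbT.
by have [] := spec_sparse_product t_range (naive _ _ _) sH sa sb.
Qed.

End Product.

(** Each nonzero column left has at least [w] nonzero entries: 1 in round 0, the previous threshold
    later. Doubling the threshold costs the factor 2. *)
Lemma card_heavy_columns (R : pzRingType) n (A B : 'M[R]_n) i (J : {set 'I_n}) :
  (0 < n)%N -> heavy (A *m B) i J ->
  (#|[set j | col j (A *m colsub (fun l : 'I_#|J| => enum_val l) B) != 0%R]%SET|
     * minn (2 ^ i) n <= 2 * nnz (A *m B))%N.
Proof.
move=> n0 he; set L := [set j | _]%SET.
pose w := if i is i'.+1 then minn (2 ^ i') n else 1%N.
have le_w : (minn (2 ^ i) n <= 2 * w)%N.
  by rewrite /w; case: (i) => [|i']; rewrite ?expnS; lia.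
apply: (@leq_trans (#|L| * (2 * w))); first by rewrite leq_mul2l le_w orbT.
rewrite mulnCA leq_mul2l; apply: (@leq_card_nnz _ _ _ _ _ _ (fun l : 'I_#|J| => enum_val l)).
  exact: enum_val_inj.
move=> l; rewrite inE => lL.
have colE : col l (A *m colsub (fun l : 'I_#|J| => enum_val l) B) =
    col (enum_val l) (A *m B).
  by apply/matrixP => k z; rewrite !mxE; apply: eq_bigr => j _; rewrite mxE.
move: lL; rewrite colE -nnz_eq0 -lt0n /w; case: (i) he => // i' he _.
by have [//|/ltnW] := he _ (enum_valP l).
Qed.

Lemma up_log_le_log2 (K : realType) n : (1 < n)%N ->
  (up_log 2 n).+1%:R <= 3 * log2 K n.
Proof.
move=> n1; have ln2 : 0 < ln 2 :> K by rewrite ln_gt0 // ltr1n.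
have l1 : 1 <= log2 K n.
  by rewrite /log2 ler_pdivlMr // mul1r ler_ln ?posrE ?ltr0n ?ler_nat // ltnW.
have : (up_log 2 n).-1%:R <= log2 K n.
  rewrite /log2 ler_pdivlMr // mulr_natl -lnXn // ler_ln ?posrE ?exprn_gt0 ?ltr0n //.
    by rewrite -natrX ler_nat ltnW // up_log_gtn.
  exact: ltnW.
have : (0 < up_log 2 n)%N by rewrite up_log_gt0.
case: (up_log 2 n) => // u _ /= le_u.
rewrite -addn2 natrD; lra.
Qed.

Theorem theorem3p6 (K : realType) (R : pzRingType) (m : nat -> nat -> nat)
    (H : forall n t : nat, 'M[R]_(m n t, n)) (MR : cs_pair R m)
    (V : col_mmv_alg R) (alpha : K) :
  cs_scheme H MR ->
  0 < alpha ->
  (exists C : K, forall n t : nat, (1 <= t <= n)%N ->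
     (m n t)%:R <= C * (t%:R * n%:R `^ alpha)) ->
  column_wise_mmv V ->
  (forall P : product_alg R m, correct_product H P ->
   forall (n : nat) (A B : 'M[R]_n) (s : seq R) (a b c : 'M[nat]_n),
     holds s a A -> holds s b B ->
     computes s (alg2 MR V P a b c) (A *m B))
  /\
  (forall (TM TR TH : nat -> nat -> nat) (TV : nat -> nat -> nat -> nat),
     nondecreasing2 TM -> nondecreasing2 TR -> nondecreasing2 TH ->
     nondecreasing3 TV ->
     sensing_time MR TM -> recovery_time MR TR -> sensing_mul_time H TH ->
     col_mmv_time V TV ->
   exists P : product_alg R m, correct_product H P /\
   forall delta : K, 0 <= delta <= 2 ->
   forall c0 eps : K, 0 < eps ->
   let beta : K :=
     if delta + alpha <= 1 + omega_perp R K then 2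
     else omega R (delta + alpha - 1) 1 1 in
   exists (C : K) (k N : nat), forall n : nat, (N <= n)%N ->
   forall (A B : 'M[R]_n) (s : seq R) (a b c : 'M[nat]_n),
     holds s a A -> holds s b B ->
     (nnz (A *m B))%:R <= c0 * n%:R `^ delta ->
     (ops (exec (alg2 MR V P a b c) s))%:R <=
       C * log2 K n ^+ k *
       (n%:R `^ (beta + eps)
        + (TM n n + n * TR n n + TH n n + TV n n n)%:R)).
Proof.
move=> scheme alpha0 [Cm leCm] mmv; split=> [P|TM TR TH TV]; first exact: alg2_correct.
move=> monoM monoR monoH monoV timeM timeR timeH timeV.
(* A dummy program for [t] out of range makes the family total, so that choice applies. *)
have exPH n t : exists PH, (1 <= t <= n)%N ->
    forall s aH aX X, holds s aH (H n t) -> holds s aX X ->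
    spec idfun true (PH aH aX : prog R 'M[nat]_(m n t, n)) s
      (fun s' d => holds s' d (H n t *m X)) (TH n t).
  have [t_range|] := boolP (1 <= t <= n)%N.
    by have [PH HPH] := timeH n t t_range; exists PH.
  by exists (fun _ _ => Ret (const_mx 0%N)).
pose PH n t := sval (cid (exPH n t)).
have spec_PH n t := svalP (cid (exPH n t)).
exists (sparse_product V PH).
split; first exact: (sparse_product_correct mmv timeV spec_PH).
move=> delta delta02 c0 eps eps0 beta.
(* The factor 2 is that of [card_heavy_columns]; [Cm] may be negative and is replaced by its
   positive part. *)
pose c := 2 * Num.max Cm 0 * c0.
have [C HC] := cheap_products_beta R (delta + alpha) eps0 c.
pose C' := Num.max C 0.
have C'0 : 0 <= C' by rewrite le_max lexx orbT.
(* The number of rounds is at most 3 log n once n is at least 2. The 2 covers the two calls of [V]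
   per round, and [C'] the matrix product. *)
exists (3 * Num.max 2 C'), 1%N, 2%N => n n1 A B s a b c' sa sb nnzAB.
have n0 : (0 < n)%N by apply: ltnW.
pose W : K := n%:R `^ (beta + eps).
have W0 : 0 <= W by apply: powR_ge0.
(* Operation counts are natural numbers, so the real bound may be rounded down. *)
pose X := `|Num.floor (C' * W)|%N.
have XE : X%:R = (Num.floor (C' * W))%:~R :> K.
  by rewrite /X natr_absz ger0_norm // floor_ge0 mulr_ge0.
have leX L : L%:R <= C * W -> (L <= X)%N.
  move=> leL; rewrite -(ler_nat K) XE -[L%:R]/(L%:~R) ler_int floor_ge_int.
  by apply: le_trans leL _; apply: ler_wpM2r; rewrite // le_max lexx.
pose S := (TM n n + n * TR n n + TH n n + TV n n n)%N.
have [_] : spec idfun true (alg2 MR V (sparse_product V PH) a b c') s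
    (fun s' d => holds s' d (A *m B)) ((up_log 2 n).+1 * (2 * S + X)).
  apply: (spec_alg2 _ n0 _ sa sb) => i J c1 s1 lei sa1 sb1 co he.
  pose t := minn (2 ^ i) n.
  have t_range : (1 <= t <= n)%N by rewrite leq_min expn_gt0 n0 geq_minr.
  have tn : (t <= n)%N by rewrite geq_minr.
  have Jn : (#|J| <= n)%N by rewrite -[leqRHS]card_ord max_card.
  pose B' := colsub (fun l : 'I_#|J| => enum_val l) B.
  pose q := #|[set j | col j (A *m B') != 0]%SET|.
  have qn : (q <= n)%N.
    by apply: leq_trans Jn; rewrite -[leqRHS]card_ord max_card.
  have qt : (q * t <= 2 * nnz (A *m B))%N by apply: card_heavy_columns.
  (* The dense product has min(m, n) rows, and m q is at most a constant times n^alpha t q, where t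
     q is at most 2 nnz(A B). *)
  have [L [mul_L leL]] : exists L,
      mul_within R (minn (m n t) n) n q L /\ L%:R <= C * W.
    apply: HC => //; first exact: geq_minr.
    apply: (@le_trans _ _ ((m n t)%:R * q%:R)).
      by rewrite ler_wpM2r // ler_nat geq_minl.
    apply: (@le_trans _ _ (Num.max Cm 0 * (t%:R * n%:R `^ alpha) * q%:R)).
      rewrite ler_wpM2r //; apply: le_trans (leCm _ _ t_range) _.
      by rewrite ler_wpM2r ?mulr_ge0 ?powR_ge0 // le_max lexx.
    have -> : Num.max Cm 0 * (t%:R * n%:R `^ alpha) * q%:R =
        Num.max Cm 0 * n%:R `^ alpha * (q * t)%:R by rewrite natrM; ring.
    apply: (@le_trans _ _ (Num.max Cm 0 * n%:R `^ alpha * (2 * (c0 * n%:R `^ delta)))).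
      rewrite ler_wpM2l ?mulr_ge0 ?powR_ge0 // ?le_max ?lexx ?orbT //.
      apply: (@le_trans _ _ (2 * nnz (A *m B))%:R); first by rewrite ler_nat.
      by rewrite natrM ler_wpM2l.
    rewrite powRD; last by apply/implyP => _; rewrite pnatr_eq0 -lt0n.
    by apply/eqP/eqP; rewrite le_eqVlt /c; apply/orP; left; apply/eqP; ring.
  have {}mul_L : mul_within R (if (m n t <= n)%N || (n < q)%N then m n t else n) n q L.
    move: mul_L; rewrite [(n < q)%N]ltnNge qn orbF /minn.
    by case: ltngtP => // ->.
  apply: spec_weaken (spec_alg2_step (cM := TM n n) (cP := TV n n n + (TH n n + X))
    (cR := TR n n) (cV := TV n n n) scheme mmv n0 _ _ _ _ sa1 sb1 co) _ _ => //.
  - by move=> _ s2; apply: leq_trans (timeM n t s2 t_range) _; apply: monoM.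
  - move=> s2 aH a2 b2 sH sa2 sb2.
    apply: spec_weaken (spec_sparse_product mmv timeV spec_PH t_range mul_L sH sa2 sb2) _ _ => //.
    apply: leq_add; first exact: monoV.
    by apply: leq_add; [apply: monoH|apply: leX].
  - move=> _ s2 a2 y sa2; apply: leq_trans (timeR n t s2 a2 y t_range sa2) _.
    exact: monoR.
  - move=> _ s2 a2 b2 c2 B2 C2 sa2 sb2 sc2.
    by apply: leq_trans (timeV _ _ _ _ _ _ _ _ _ _ sa2 sb2 sc2) _; apply: monoV.
  have : (#|J| * TR n n <= n * TR n n)%N by rewrite leq_mul2r Jn orbT.
  by rewrite /S; lia.
rewrite implyTb -(ler_nat K) => /le_trans; apply.
rewrite expr1 natrM.
have l0 := up_log_le_log2 K n1.
apply: (@le_trans _ _ (3 * log2 K n * (2 * S + X)%:R)); first by rewrite ler_wpM2r.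
have -> : 3 * Num.max 2 C' * log2 K n * (W + S%:R) =
  3 * log2 K n * (Num.max 2 C' * (W + S%:R)) by ring.
apply: ler_wpM2l; first exact: le_trans l0.
rewrite natrD natrM mulrDr addrC; apply: lerD.
  apply: (@le_trans _ _ (C' * W)); first by rewrite XE floor_le.
  by rewrite ler_wpM2r // le_max lexx orbT.
by rewrite ler_wpM2r // le_max lexx.
Qed.
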